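(* Let $G=\mathrm{Sp}_{2l}(q)$, $\tilde G=\mathrm{CSp}_{2l}(q)$, and let $N=\mathrm N_G(\mathbf T_0)$, $\tilde N=\mathrm N_{\tilde G}(\mathbf T_0)$ for the torus $\mathbf T_0$ attached to the standard Levi subgroup of type $\mathsf C_1$. Every character $\psi\in\mathrm{Irr}(N)$ satisfies $$(\tilde N\rtimes D)_\psi=\tilde N_\psi\,(ND)_\psi.$$
   Context: $\mathbf G$ is the simple simply connected group of type $\mathsf C_l$ over an algebraic closure of $\mathbb F_p$, with maximal torus $\mathbf T$, root subgroups $\mathbf X_\alpha=\{x_\alpha(t)\}$ (Chevalley generators), base $\{\alpha_1,\dots,\alpha_l\}$ with $\alpha_1$ the long simple root. $F_0$ is the field endomorphism $x_\alpha(t)\mapsto x_\alpha(t^p)$, $F=F_0^m$, $q=p^m$, $G=\mathbf G^F=\mathrm{Sp}_{2l}(q)$. $\tilde{\mathbf G}=\mathbf G\times_{\mathrm Z(\mathbf G)}\mathbf Z$ is the central product with a torus $\mathbf Z$ containing $\mathrm Z(\mathbf G)$, of rank equal to the rank of $\mathrm Z(\mathbf G)$ as an abelian group, with $F_0$ acting by $x\mapsto x^p$ on $\mathbf Z$; $\tilde G=\tilde{\mathbf G}^F=\mathrm{CSp}_{2l}(q)$. $D=\langle F_0\rangle\le\mathrm{Aut}(G)$ (field automorphisms), also acting on $\tilde G$. $\mathbf L=\langle\mathbf T,\mathbf X_{\alpha_1},\mathbf X_{-\alpha_1}\rangle$ is the standard Levi subgroup of type $\mathsf C_1$, $L=\mathbf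 L^F$, and $\mathbf T_0:=\mathrm C_{\mathbf G}^\circ(\mathbf L)$, an $F$- and $D$-stable torus with $L=\mathrm C_G(\mathbf T_0)$. A subscript $\psi$ denotes the stabiliser of $\psi$. *)

(* Defs.v *)
From HB Require Import structures.
From mathcomp Require Import all_boot all_order all_algebra all_fingroup.
From mathcomp Require Import all_solvable all_field all_character.
From mathcomp Require mpoly.
From mathcomp Require Import boolp classical_sets topology_structure connected.

(* mpoly's notations are incompatible with those of the topology library. *)
Import (canonicals) mpoly.

Set Implicit Arguments.
Unset Strict Implicit.
Unset Printing Implicit Defensive.

Import GroupScope GRing.Theory.
Local Open Scope ring_scope.

(* [zmatrix K n] is 'M[K]_n with the Zariski topology of affine n^2-space.
   It is an alias because the instances that the topology library puts on
   'M[K]_n itself give a product topology. *)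
Section Zariski.
Variables (K : fieldType) (n : nat).

Definition zmatrix : Type := 'M[K]_n.
HB.instance Definition _ := Choice.copy zmatrix 'M[K]_n.

Definition zeval (f : mpoly.mpoly (n * n) K) (x : zmatrix) : K :=
  mpoly.meval (fun k => mxvec (x : 'M[K]_n) 0 k) f.

Definition zlocus (S : set (mpoly.mpoly (n * n) K)) : set zmatrix :=
  [set x | forall f, S f -> zeval f x = 0]%classic.

Definition zopen (A : set zmatrix) : Prop :=
  exists S, A = (~` zlocus S)%classic.

Fact zopenT : zopen [set: zmatrix]%classic.
Proof.
exists [set 1]%classic; apply/seteqP; split=> // x _ /(_ _ erefl) /eqP.
by rewrite /zeval mpoly.meval1 oner_eq0.
Qed.

Fact zopenI (A B : set zmatrix) :
  zopen A -> zopen B -> zopen (A `&` B)%classic.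
Proof.
move=> [S ->] [S' ->].
exists [set f | exists g h, [/\ S g, S' h & f = g * h]]%classic.
apply/seteqP; split=> [x [nS nS'] Z | x nZ].
  apply: nS => g Sg; apply/eqP; apply: contrapT => /negP gx.
  apply: nS' => h Sh.
  have /eqP : zeval (g * h) x = 0 by apply: Z; exists g, h.
  by rewrite /zeval mpoly.mevalM mulf_eq0 (negPf gx) => /eqP.
split=> Z; apply: nZ => _ [g [h [Sg Sh ->]]]; rewrite /zeval mpoly.mevalM.
  by rewrite [X in X * _](Z g Sg) mul0r.
by rewrite [X in _ * X](Z h Sh) mulr0.
Qed.

Fact zopen_bigU (I : Type) (f : I -> set zmatrix) :
  (forall i, zopen (f i)) -> zopen (\bigcup_i f i)%classic.
Proof.
move=> /choice[S fS]; exists (\bigcup_i S i)%classic.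
apply/seteqP; split=> [x [i _] | x nZ].
  by rewrite fS => nSi Z; apply: nSi => g Sg; apply: Z; exists i.
apply: contrapT => nU; apply: nZ => g [i _ Sg].
apply: contrapT => gx; apply: nU; exists i => //.
by rewrite fS => /(_ g Sg).
Qed.

HB.instance Definition _ := isOpenTopological.Build zmatrix
  zopenT zopenI zopen_bigU.

End Zariski.

Section MatrixGroups.
Variables (K : fieldType) (n : nat).

Definition mxsubgroup (H : set 'M[K]_n) : Prop :=
  [/\ H 1%:M, forall x, H x -> x \in unitmx,
      forall x y, H x -> H y -> H (x *m y) & forall x, H x -> H (invmx x)].

Definition mxcent (H S : set 'M[K]_n) : set 'M[K]_n :=
  [set x | H x /\ forall y, S y -> x *m y = y *m x]%classic.

Definition mxconj (g : 'M[K]_n) (S : set 'M[K]_n) : set 'M[K]_n :=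
  [set g *m x *m invmx g | x in S]%classic.

(* The identity component H^o, for the Zariski topology. *)
Definition mxcomp1 (H : set 'M[K]_n) : set 'M[K]_n :=
  connected_component (H : set (zmatrix K n)) (1%:M : 'M[K]_n).

End MatrixGroups.

(* Throughout, the rank is l.+1 >= 1, and matrices have size l.+1 + l.+1;
   with this form of the size, {'GL_(l.+1 + l.+1)[F]} is (by conversion) the
   group of units of 'M[F]_(l.+1 + l.+1). *)
Section AlgebraicGroups.
Variables (K : fieldType) (l : nat).
Local Notation n := (l.+1 + l.+1)%N.

Definition symp_form : 'M[K]_n := block_mx 0 1%:M (- 1%:M) 0.

Definition Sp : set 'M[K]_n :=
  [set x | x^T *m symp_form *m x = symp_form]%classic.

(* The central product of Sp with the torus of scalar matrices. *)
Definition tildeSp : set 'M[K]_n :=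
  [set x | exists2 z : K, z != 0 & exists2 g, Sp g & x = z *: g]%classic.

(* The diagonal maximal torus; its elements are the matrices
   diag(t_0, ..., t_l, t_0^-1, ..., t_l^-1). *)
Definition Tmax : set 'M[K]_n := [set x | Sp x /\ is_diag_mx x]%classic.

(* With e_i the i-th coordinate character of Tmax, the base is 2e_0 (long),
   e_1 - e_0, ..., e_l - e_(l-1); these are the root elements for the long
   simple root 2e_0 and for its opposite. *)
Definition x_long (t : K) : 'M[K]_n :=
  block_mx 1%:M (t *: delta_mx ord0 ord0) 0 1%:M.
Definition x_opplong (t : K) : 'M[K]_n :=
  block_mx 1%:M 0 (t *: delta_mx ord0 ord0) 1%:M.

Definition LeviC1 : set 'M[K]_n :=
  smallest (@mxsubgroup K n)
    (Tmax `|` range x_long `|` range x_opplong)%classic.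

Definition T0 : set 'M[K]_n := mxcomp1 (mxcent Sp LeviC1).

Lemma symp_form_unit : symp_form \in unitmx.
Proof.
case: (@mulmx1_unit K n symp_form (- symp_form)) => //.
rewrite /symp_form mulmxN mulmx_block !mulmx0 !mul0mx !mulmx1 !add0r !addr0.
by rewrite !mul1mx opp_block_mx !oppr0 opprK scalar_mx_block.
Qed.

Lemma Sp_subgroup : mxsubgroup Sp.
Proof.
have spE x : Sp x -> x^T *m symp_form *m x = symp_form by [].
have spU x : Sp x -> x \in unitmx.
  by move=> /spE Sx; have := symp_form_unit; rewrite -Sx !unitmx_mul => /andP[].
split=> // [|x y Sx Sy|x Sx]; rewrite /Sp /=.
- by rewrite trmx1 mul1mx mulmx1.
- rewrite trmx_mul -!mulmxA (mulmxA symp_form) (mulmxA x^T) (mulmxA x^T).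
  by rewrite (spE x Sx) mulmxA spE.
have Ux := spU x Sx; rewrite -[X in _ *m X *m _](spE x Sx) trmx_inv.
by rewrite !mulmxA mulVmx ?unitmx_tr // mul1mx mulmxK.
Qed.

Lemma tildeSp_subgroup : mxsubgroup tildeSp.
Proof.
have [S1 SU SM SV] := Sp_subgroup; split.
- by exists 1; [rewrite oner_eq0 | exists 1%:M; rewrite ?scale1r].
- by move=> _ [z nz_z [g Sg ->]]; rewrite unitmxZ ?unitfE // SU.
- move=> _ _ [z nz_z [g Sg ->]] [w nz_w [h Sh ->]].
  exists (z * w); first by rewrite mulf_neq0.
  exists (g *m h); first exact: SM.
  by rewrite -scalemxAl -scalemxAr scalerA.
move=> _ [z nz_z [g Sg ->]]; exists z^-1; first by rewrite invr_eq0.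
by exists (invmx g); [exact: SV | rewrite invmxZ // unitmxZ ?unitfE // SU].
Qed.

End AlgebraicGroups.

Section FiniteGroups.
Variables (p m l : nat) (p_pr : prime p).
Variables (Fq : finFieldType) (cardFq : #|Fq| = (p ^ m)%N).
Variables (K : closedFieldType) (iota : {rmorphism Fq -> K}).
Local Notation n := (l.+1 + l.+1)%N.
Local Notation GLq := {'GL_n[Fq]}.

Definition GLmx (g : GLq) : 'M[K]_n := map_mx iota (GLval g).

(* The field endomorphism F_0 of 'M[K]_n; it sends x_long t to x_long (t^p),
   and similarly for all root elements, whose entries are 0, 1, t or -t. *)
Definition F0mx (x : 'M[K]_n) : 'M[K]_n := map_mx (fun a => a ^+ p) x.

(* F_0^m-fixed points, i.e. the matrices over K with entries in iota(Fq)
   (see [F0mx_fixedP]), as a set of invertible matrices over Fq. *)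
Definition Fpoints (H : set 'M[K]_n) : {set GLq} :=
  [set g : GLq | `[< H (GLmx g) >]]%SET.

Definition normT0 (H : {set GLq}) : {set GLq} :=
  [set g in H | `[< mxconj (GLmx g) (@T0 K l) = @T0 K l >]]%SET.

Definition Gq : {set GLq} := Fpoints (@Sp K l).
Definition tGq : {set GLq} := Fpoints (@tildeSp K l).
Definition Nq : {set GLq} := normT0 Gq.
Definition tNq : {set GLq} := normT0 tGq.

Lemma F0mx_fixedP (x : 'M[K]_n) :
  iter m F0mx x = x <-> exists y : 'M[Fq]_n, x = map_mx iota y.
Proof.
have iterF k : iter k F0mx x = map_mx (fun a => a ^+ (p ^ k)) x.
  elim: k => [|k IHk]; first by apply/matrixP=> i j; rewrite !mxE expr1.
  by rewrite iterS IHk; apply/matrixP=> i j; rewrite !mxE -exprM expnSr.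
rewrite iterF; split=> [fx | [y ->]]; last first.
  by apply/matrixP=> i j; rewrite !mxE -rmorphXn -cardFq expf_card.
suffices im i j : exists a : Fq, x i j = iota a.
  have /choice[f Df] (ij : 'I_n * 'I_n) := im ij.1 ij.2.
  exists (\matrix_(i, j) f (i, j)).
  by apply/matrixP=> i j; rewrite !mxE; apply: Df (i, j).
have: root (\prod_(a <- enum Fq) ('X - (iota a)%:P)) (x i j).
  rewrite -(map_prod_XsubC iota _ predT id) /= big_enum -finField_genPoly.
  have := congr1 (fun y : 'M_n => y i j) fx; rewrite mxE -cardFq => fxij.
  by rewrite rmorphB /= map_polyXn map_polyX rootE !hornerE fxij subrr.
rewrite -(big_map iota predT (fun b => 'X - b%:P)) root_prod_XsubC.
by case/mapP=> a _ ->; exists a.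
Qed.

Lemma GLmx1 : GLmx 1%g = 1%:M.
Proof. by rewrite /GLmx map_scalar_mx rmorph1. Qed.

Lemma GLmxM g h : GLmx (g * h)%g = GLmx g *m GLmx h.
Proof. by rewrite /GLmx -map_mxM. Qed.

Lemma GLmx_unit g : GLmx g \in unitmx.
Proof. by rewrite map_unitmx; apply: (GL_unit g). Qed.

Lemma GLmxV g : GLmx g^-1%g = invmx (GLmx g).
Proof. by rewrite /GLmx -map_invmx. Qed.

Lemma map_symp_form : map_mx iota (symp_form Fq l) = symp_form K l.
Proof.
by rewrite map_block_mx map_mxN !map_mx0 map_scalar_mx rmorph1.
Qed.

Lemma mem_Gq g :
  (g \in Gq) = ((GLval g)^T *m symp_form Fq l *m GLval g == symp_form Fq l).
Proof.
rewrite inE; apply/asboolP/eqP => [|Sg]; rewrite /Sp /=.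
  by rewrite -map_symp_form map_trmx -!map_mxM => /map_mx_inj.
by rewrite -map_symp_form map_trmx -!map_mxM Sg.
Qed.

(* tGq is the conformal symplectic group over Fq. *)
Lemma mem_tGq g : (g \in tGq) =
  [exists c : Fq, (c != 0)
     && ((GLval g)^T *m symp_form Fq l *m GLval g == c *: symp_form Fq l)].
Proof.
rewrite inE; apply/asboolP/existsP => [[z nz_z [h Sh Dg]] | [c]].
  have Eg: map_mx iota ((GLval g)^T *m symp_form Fq l *m GLval g)
           = z ^+ 2 *: symp_form K l.
    rewrite !map_mxM -map_trmx map_symp_form -/(GLmx g) Dg.
    rewrite [(_ *: _)^T]linearZ /= -!scalemxAl -scalemxAr scalerA.
    by congr (_ *: _); apply: Sh.
  pose c := ((GLval g)^T *m symp_form Fq l *m GLval g)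
              (lshift l.+1 ord0) (rshift l.+1 ord0).
  have Dc: iota c = z ^+ 2.
    have /matrixP/(_ (lshift l.+1 ord0) (rshift l.+1 ord0)) := Eg.
    by rewrite mxE [RHS]mxE block_mxEur [1%:M _ _]mxE eqxx mulr1.
  exists c; rewrite -(fmorph_eq0 iota) Dc expf_neq0 //=.
  apply/eqP/(@map_mx_inj _ _ iota).
  by rewrite Eg map_mxZ map_symp_form Dc.
case/andP=> nz_c /eqP Dc; have [z Dz] : exists z : K, z ^+ 2 = iota c.
  have [z] := @solve_monicpoly K 2 (nth 0 [:: iota c]) isT.
  by rewrite !big_ord_recl big_ord0 /= expr0 mulr1 mul0r !addr0; exists z.
have nz_z : z != 0.
  by apply: contraNneq nz_c => z0; rewrite -(fmorph_eq0 iota) -Dz z0 expr0n.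
exists z => //; exists (z^-1 *: GLmx g); last by rewrite scalerA divff ?scale1r.
rewrite /Sp /= [(_ *: _)^T]linearZ /= -!scalemxAl -scalemxAr scalerA.
rewrite -map_symp_form /GLmx map_trmx -!map_mxM Dc map_mxZ scalerA -Dz.
by rewrite -invfM -expr2 mulVf ?scale1r // expf_neq0.
Qed.

Lemma Fpoints_group_set (H : set 'M[K]_n) :
  mxsubgroup H -> group_set (Fpoints H).
Proof.
case=> H1 _ HM _; apply/group_setP; split.
  by rewrite inE GLmx1; apply: asboolT.
by move=> g h; rewrite !inE GLmxM; apply: HM.
Qed.

Definition Gq_group : {group GLq} :=
  Group (Fpoints_group_set (@Sp_subgroup K l)).
Definition tGq_group : {group GLq} :=
  Group (Fpoints_group_set (@tildeSp_subgroup K l)).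

Lemma normT0_group_set (H : {group GLq}) : group_set (normT0 H).
Proof.
apply/group_setP; split.
  rewrite inE group1 GLmx1; apply/asboolP; rewrite /mxconj invmx1.
  by rewrite -[RHS]image_id; apply: eq_imagel => x _; rewrite mul1mx mulmx1.
move=> g h; rewrite !inE => /andP[Hg /asboolP Ng] /andP[Hh /asboolP Nh].
rewrite groupM //; apply/asboolP; rewrite GLmxM -[RHS]Ng -{2}Nh /mxconj.
rewrite image_comp -GLmxM -!GLmxV invMg !GLmxM; apply: eq_imagel => x _ /=.
by rewrite !mulmxA.
Qed.

Canonical normT0_group (H : {group GLq}) := Group (normT0_group_set H).
Definition Nq_group : {group GLq} := Group (normT0_group_set Gq_group).
Definition tNq_group : {group GLq} := Group (normT0_group_set tGq_group).

Local Notation frob := (pFrobenius_aut (card_finPcharP cardFq p_pr)).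

Definition F0fun (g : GLq) : GLq :=
  FinRing.unit _ (etrans (map_unitmx frob (GLval g)) (GL_unit g)).

Lemma GLmx_F0fun g : GLmx (F0fun g) = F0mx (GLmx g).
Proof. by apply/matrixP=> i j; rewrite !mxE -rmorphXn. Qed.

Lemma F0fun_inj : injective F0fun.
Proof.
by move=> g h [] /(@map_mx_inj _ _ frob) eq_gh; apply: val_inj.
Qed.

Definition F0 : {perm GLq} := perm F0fun_inj.

Lemma F0_Aut : F0 \in Aut [set: GLq]%G.
Proof.
rewrite inE; apply/andP; split.
  by apply/fintype.subsetP=> g _; rewrite inE.
apply/morphicP=> g h _ _; rewrite !permE; apply: val_inj => /=.
by rewrite [LHS]map_mxM.
Qed.

(* F_0 acts faithfully on Gq, so this copy of D inside Aut GL(Fq) restricts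
   isomorphically onto the group generated by F_0 in Aut Gq and in Aut tGq;
   see [D_faithful]. *)
Definition D : {group {perm GLq}} := <[F0]>%G.

Lemma D_sub_Aut : D \subset Aut [set: GLq]%G.
Proof. by rewrite cycle_subG F0_Aut. Qed.

Lemma F0X k g i j : GLval ((F0 ^+ k)%g g) i j = GLval g i j ^+ (p ^ k).
Proof.
elim: k => [|k IHk]; first by rewrite perm1 expr1.
by rewrite expgSr permM permE mxE IHk expnSr exprM.
Qed.

Lemma D_faithful (a : {perm GLq}) :
  a \in D -> {in Gq, forall g, a g = g} -> a = 1%g.
Proof.
case/cycleP=> k -> fixG; apply/permP=> g; rewrite perm1; apply: val_inj.
apply/matrixP=> i j; rewrite [LHS]F0X; move: (GLval g i j) => t {g i j}.
have Sx : (x_long l t)^T *m symp_form Fq l *m x_long l t = symp_form Fq l.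
  rewrite tr_block_mx !trmx1 trmx0 linearZ /= trmx_delta /symp_form.
  rewrite !mulmx_block !mul0mx !mulmx0 !mulmx1 !mul1mx !addr0 !add0r.
by rewrite mul0mx add0r mulNmx mul1mx addNr.
have Ux : x_long l t \is a GRing.unit.
  by have [_ SU _ _] := @Sp_subgroup Fq l; apply: SU.
pose x : GLq := FinRing.unit _ Ux.
pose i0 := lshift l.+1 (ord0 : 'I_l.+1).
pose j0 := rshift l.+1 (ord0 : 'I_l.+1).
have xE : x_long l t i0 j0 = t by rewrite block_mxEur !mxE !eqxx mulr1.
have xk : GLval ((F0 ^+ k)%g x) i0 j0 = x_long l t i0 j0.
  by rewrite fixG // mem_Gq; apply/eqP.
by have /esym := F0X k x i0 j0; rewrite xk /= -/i0 xE.
Qed.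

Definition D_action : groupAction D [set: GLq] :=
  ([Aut [set: GLq]] \ D_sub_Aut)%gact.

(* All groups of the statement are realised inside the external semidirect
   product GL(Fq) ><| D. *)
Definition GLD : finGroupType := sdprod_by D_action.

Definition emb (H : {group GLq}) : {group GLD} := (sdpair1 D_action @* H)%G.
Definition embD : {group GLD} := (sdpair2 D_action @* D)%G.

End FiniteGroups.

(* Main.v *)
(* N is the direct product of a copy of SL_2(q), acting on the plane
   <e_0, f_0>, and a monomial group H = X wr S_l, where X is the normaliser of
   a torus of SL_2(q). Modulo N and scalars, CSp contributes one diagonal
   automorphism d, the conjugation by diag(gam, .., gam, 1, .., 1), where gam
   generates the multiplicative group of F_q and q may be taken to be odd. So
   it is enough to see that psi o d = psi o s implies psi o d = psi, for s a
   power of F_0, and this can be checked on both factors.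

   In SL_2(q) every class is fixed by d or by s, and a count of fixed
   characters through the second orthogonality relation concludes.

   For H, let c_j be the j-th coordinate of the torus at gam. In a
   representation where all c_j are diagonal, let S(r) be the set of the j such
   that c_j has r-th eigenvalue -1. The part of the trace of x on the r with
   S(r) = A gets multiplied by a sign when x is replaced with x^d, since 1 + c_j
   intertwines the representation and its twist by d wherever it is invertible.
   Since x^s and x only differ by squares of torus elements, x^s and x have the
   same A-part if x acts on the coordinates in A only; hence psi o d = psi o s
   forces the A-part to vanish at such an x whose sign is -1. As the stabiliser
   of A in H is a direct product of two monomial groups, Schur's lemma extends
   this vanishing to all x that stabilise A. *)

Require Import Defs.
From mathcomp Require Import all_boot all_algebra all_fingroup all_solvable.
From mathcomp Require Import all_field all_character.
From mathcomp Require Import ring.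
From mathcomp Require mpoly.
From mathcomp Require boolp classical_sets topology_structure connected.

Import (canonicals) mpoly.

Set Implicit Arguments.
Unset Strict Implicit.
Unset Printing Implicit Defensive.

Import GroupScope GRing.Theory Num.Theory.
Local Open Scope ring_scope.

(** * Twisting characters by automorphisms *)

Section Twist.
Variables (gT : finGroupType) (G : {group gT}).

(** Automorphisms are functions on all of [gT], so that one map can be restricted to several
    subgroups. *)
Definition is_auto (a : gT -> gT) :=
  [/\ {in G, forall x, a x \in G}, {in G &, injective a}
    & {in G &, {morph a : x y / (x * y)%g}}].

Variable (a : gT -> gT).
Hypothesis aP : is_auto a.

Lemma auto1 : a 1%g = 1%g.
Proof.
case: aP => _ _ aM; apply: (mulgI (a 1%g)).
by rewrite -aM ?group1 // !mulg1.
Qed.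

Lemma auto_image : a @: G = G.
Proof.
case: aP => aG aI _; apply/eqP; rewrite eqEcard card_in_imset // leqnn andbT.
by apply/subsetP=> _ /imsetP[x Gx ->]; apply: aG.
Qed.

Lemma sum_auto (R : nmodType) (F : gT -> R) :
  \sum_(x in G) F (a x) = \sum_(x in G) F x.
Proof. by case: aP => aG aI _; rewrite -[in RHS]auto_image big_imset. Qed.

Definition twist_fun n (rG : mx_representation algC G n) x := rG (a x).

Lemma twist_mx_repr n (rG : mx_representation algC G n) :
  mx_repr G (twist_fun rG).
Proof.
case: aP => aG _ aM; split; first by rewrite /twist_fun auto1 repr_mx1.
by move=> x y Gx Gy; rewrite /twist_fun aM // repr_mxM ?aG.
Qed.

Definition twist_repr n rG := MxRepresentation (@twist_mx_repr n rG).

(** The twisted representation has a character of the same norm, since [a] permutes [G]. *)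
Lemma irr_twist (chi : 'CF(G)) : chi \in irr G ->
  exists2 chi', chi' \in irr G & {in G, forall x, chi' x = chi (a x)}.
Proof.
case/irr_reprP=> rG irrG Dchi; case: (aP) => aG _ _.
exists (cfRepr (twist_repr rG)); last first.
  by move=> x Gx; rewrite Dchi !cfunE Gx aG.
rewrite irrEchar cfRepr_char /=.
have: cfRepr rG \in irr G by apply/irr_reprP; exists rG.
move/irrWnorm => <-; rewrite !cfdotE; apply/eqP; congr (_ * _).
rewrite -[RHS]sum_auto; apply: eq_bigr => x Gx.
by rewrite !cfunE Gx aG.
Qed.

End Twist.

Section EqualTwists.
Variables (gT : finGroupType) (G : {group gT}).

(** Both twists of an irreducible character are irreducible, so their inner product is the indicator
    of their equality. Summing over all characters and exchanging the sums brings in the second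
    orthogonality relation. *)
Lemma card_eq_twist (a b : gT -> gT) : is_auto G a -> is_auto G b ->
  #|[set i | [forall x in G, 'chi[G]_i (a x) == 'chi_i (b x)]]|%:R =
  #|G|%:R^-1 * \sum_(x in G | a x \in b x ^: G) #|'C_G[x]|%:R :> algC.
Proof.
move=> aP bP; have [aG aI aM] := aP; have [bG bI bM] := bP.
rewrite -sum1_card natr_sum.
transitivity (\sum_i #|G|%:R^-1 *
   \sum_(x in G) 'chi[G]_i (a x) * ('chi_i (b x))^*).
  rewrite big_mkcond; apply: eq_bigr => i _; rewrite inE.
  have [_ /irrP[ia ->] Da] := irr_twist aP (mem_irr i).
  have [_ /irrP[ib ->] Db] := irr_twist bP (mem_irr i).
  have := cfdot_irr ia ib; rewrite cfdotE => Dab.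
  rewrite (eq_bigr (fun x => 'chi_ia x * ('chi_ib x)^*)); last first.
    by move=> x Gx; rewrite Da ?Db.
  rewrite Dab; case: eqP => [eq_ab | ne_ab].
    rewrite ifT //; apply/forall_inP=> x Gx; apply/eqP.
    by rewrite -Da // -Db // eq_ab.
  rewrite ifF //; apply/negP=> /forall_inP eq_ab; case: ne_ab.
  apply: irr_inj; apply/cfun_inP=> x Gx; rewrite Da ?Db //.
  exact/eqP/eq_ab.
rewrite -big_distrr /= exchange_big /= [in RHS]big_mkcondr /=.
congr (_ * _); apply: eq_bigr => x Gx;
  rewrite second_orthogonality_relation ?bG //.
have Cx: #|'C_G[a x]| = #|'C_G[x]|.
  transitivity #|a @: 'C_G[x]|; last first.
    by apply: card_in_imset => y z /setIP[Gy _] /setIP[Gz _]; apply: aI.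
  rewrite -[in LHS](auto_image aP).
  apply/eq_card=> y; rewrite inE; apply/andP/imsetP.
    case=> /imsetP[z Gz ->] /cent1P cza; exists z => //.
    rewrite inE Gz; apply/cent1P; apply: aI; rewrite ?groupM //.
    by rewrite !aM.
  case=> z /setIP[Gz /cent1P czx ->]; split; first exact: imset_f.
  by apply/cent1P; rewrite /commute -!aM // czx.
by rewrite Cx; case: ifP.
Qed.

(* By [card_eq_twist], the hypothesis gives
   #{chi s = chi} + #{chi d = chi} = #{chi} + #{chi d = chi s},
   while {chi s = chi, chi d <> chi} has at most #{chi} - #{chi d = chi}
   elements. *)
Lemma eq_twist_fixed (d s : gT -> gT) : is_auto G d -> is_auto G s ->
    {in G, forall x, (d x \in x ^: G) || (s x \in x ^: G)} ->
  forall chi, chi \in irr G -> {in G, forall x, chi (d x) = chi (s x)} ->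
  {in G, forall x, chi (d x) = chi x}.
Proof.
move=> dP sP ds_class _ /irrP[i ->] eq_ds.
have idP : is_auto G id by split=> // x y.
have [dG dI dM] := dP; have [sG sI sM] := sP.
pose A (a b : gT -> gT) :=
  [set i | [forall x in G, 'chi[G]_i (a x) == 'chi_i (b x)]].
have A_P a b k : reflect {in G, forall x, 'chi_k (a x) = 'chi_k (b x)}
                         (k \in A a b).
  by rewrite inE; apply: (iffP forall_inP) => eq_ab x Gx; apply/eqP/eq_ab.
have cardA: (#|A s id| + #|A d id| = #|A id id| + #|A d s|)%N.
  apply/eqP; rewrite -(eqr_nat algC) !natrD !card_eq_twist // -!mulrDr.
  apply/eqP; congr (_ * _).
  (* The equality holds term by term. If [d x] is conjugate to [x], it is conjugate to [s x] exactly
     when [s x] is conjugate to [x]; otherwise [s x] is conjugate to [x] and [d x] is not conjugate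
     to [s x]. *)
  rewrite !big_mkcondr -!big_split /=.
  apply: eq_bigr => x Gx; rewrite class_refl.
  have := ds_class x Gx; case dx: (d x \in _) => /=; last first.
    move=> sx; rewrite sx addr0; case: ifP; rewrite ?addr0 //.
    by rewrite (class_eqP sx) dx.
  move=> _; rewrite addrC; congr (_ + _).
  by rewrite -(class_eqP dx) class_sym.
have AidT : A id id = [set: Iirr G] by apply/setP=> k; rewrite [RHS]inE;
  apply/A_P.
have Eds: A d s :&: A d id = A s id :&: A d id.
  apply/setP=> k; rewrite !(in_setI _ (A _ _)); apply: andb_id2r => /A_P eq_d.
  apply/A_P/A_P=> eq_k x Gx; first by rewrite -eq_k // eq_d.
  by rewrite eq_k // eq_d.
suffices /setIidPl/setP/(_ i): A d s \subset A d id.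
  have Ads: i \in A d s by apply/A_P.
  by rewrite inE Ads => /A_P.
(* After adding the size of the union of [A s id] and [A d id], [cardA] reduces the inequality to
   the bound of this union by the number of all characters. *)
apply/setIidPl/eqP; rewrite eqEcard subsetIl /= Eds.
rewrite -(leq_add2l #|A s id :|: A d id|) cardsUI cardA leq_add2r AidT.
exact: subset_leq_card (subsetT _).
Qed.

End EqualTwists.

(** * Monomial characters *)

Section Codiagonal.
Variables (gT : finGroupType) (H : {group gT}) (I : finType) (c : I -> gT).
Hypotheses (cH : forall j, c j \in H) (cC : forall j k, commute (c j) (c k)).

(** The minimal polynomial divides ['X^o - 1], whose roots, the powers of a primitive root of unity,
    are distinct. *)
Lemma root1_diagonalizable n (A : 'M[algC]_n.+1) o :
  (0 < o)%N -> A ^+ o = 1 -> diagonalizable A.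
Proof.
move=> o_gt0 Ao; have [z zP] := C_prim_root_exists o_gt0.
apply/diagonalizableP; exists [seq z ^+ i | i <- index_iota 0 o].
  rewrite map_inj_in_uniq ?iota_uniq // => i j; rewrite !mem_index_iota /=.
  move=> io jo /eqP; rewrite (eq_prim_root_expr zP) !modn_small //.
  exact: eqP.
rewrite big_map factor_Xn_sub_1 //; apply: mxminpoly_min.
by rewrite rmorphB rmorph1 /= rmorphXn /= horner_mx_X Ao subrr.
Qed.

(** The [c j] commute and have finite order, hence are simultaneously diagonalisable; the change of
    basis keeps the character. *)
Lemma codiagonal_repr n (rG : mx_representation algC H n) :
  mx_irreducible rG ->
  exists2 rG' : mx_representation algC H n, mx_irreducible rG' &
    cfRepr rG' = cfRepr rG /\ forall j, is_diag_mx (rG' (c j)).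
Proof.
move=> irrG; case: n rG irrG => [|n] rG irrG; first by case/mx_irrP: irrG.
pose Cs := [seq rG (c j) | j <- enum I].
have [|P uP /allP PCs] := iffLR (codiagonalizableP Cs).
  split=> [_ _ /mapP[j _ ->] /mapP[k _ ->] | _ /mapP[j _ ->]].
    by rewrite /comm_mx -!repr_mxM // cC.
  apply: (@root1_diagonalizable _ _ #[c j]%g) => //.
  have: rG (c j ^+ #[c j])%g = rG (c j) ^+ #[c j]%g.
    elim: #[c j]%g => [|k IHk]; first by rewrite repr_mx1 expr0.
    by rewrite expgS repr_mxM ?groupX // IHk exprS.
  by rewrite expg_order repr_mx1.
have sim: mx_rsim rG (rconj_repr rG uP).
  exists (invmx P) => // [|x Gx]; rewrite ?row_free_unit ?unitmx_inv //=.
  by rewrite /rconj_mx !mulmxA mulVmx // mul1mx.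
exists (rconj_repr rG uP); first exact: mx_rsim_irr sim irrG.
split; first exact/esym/cfRepr_sim.
move=> j; have Cj: rG (c j) \in Cs by apply: map_f; rewrite mem_enum.
have := PCs _ Cj; by rewrite /= /similar_to conjumx.
Qed.

End Codiagonal.

(** * Monomial groups with a sign twist [delta] and a power twist [sigma] *)

Section Monomial.
Variables (gT : finGroupType) (H : {group gT}) (I : finType).
Variables (c : I -> gT) (o : nat).
Hypotheses (cH : forall j, c j \in H) (cC : forall j k, commute (c j) (c k)).
Hypotheses (o_gt0 : (0 < o)%N) (c_o : forall j, (c j ^+ o = 1)%g).
(** By [c_o], the exponent [o.-1] stands for inversion: conjugation by [x] permutes the [c j] along
    [pi x] and inverts those with [sg x j]. *)
Variables (pi : gT -> I -> I) (sg : gT -> I -> bool).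
Hypothesis pi_inj : {in H, forall x, injective (pi x)}.
Hypothesis cJ : {in H, forall x j,
  (x * c j = c (pi x j) ^+ (if sg x j then o.-1 else 1%N) * x)%g}.

(** [P'] inverts [P] as an exponent of the [c j]. Both are odd, so that raising eigenvalues to these
    powers neither destroys nor creates the value -1. *)
Variables (delta sigma : gT -> gT) (P P' : nat).
Hypotheses (deltaP : is_auto H delta) (sigmaP : is_auto H sigma).
Hypothesis delta_c : forall j, delta (c j) = c j.
Hypothesis deltaE : {in H, forall x,
  delta x = (x * \prod_j c j ^+ (if sg x j then o.-1 else 0%N))%g}.
Hypothesis sigma_c : forall j, sigma (c j) = (c j ^+ P)%g.
Hypotheses (oddP : odd P) (oddP' : odd P').
Hypothesis PP' : forall j, (c j ^+ (P * P') = c j)%g.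

(* [part A] consists of the elements supported on the coordinates in [A]. *)
Variable part : {set I} -> {set gT}.
Hypothesis part_sub : forall A, {subset part A <= H}.
Hypothesis part_cent : forall A,
  {in part A & part (~: A), forall x y, commute x y}.
Hypothesis part_stable : forall A, {in part A, forall x, pi x @: A = A}.
Hypothesis part_split : forall A : {set I}, {in H, forall x, pi x @: A = A ->
  exists x1 x2, [/\ x1 \in part A, x2 \in part (~: A), x = (x1 * x2)%g
                 & {in A, sg x =1 sg x1}]}.
(** The exponents are even because an even power of [c j] acts trivially where [c j] has eigenvalue
    -1. *)
Hypothesis sigmaE : forall A, {in part A, forall x, exists2 m : I -> nat,
  {in ~: A, forall j, m j = 0%N} &
  sigma x = (x * \prod_j c j ^+ (m j).*2)%g}.

Section DiagonalRepr.
Variables (n : nat) (rG : mx_representation algC H n).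
Hypothesis irrG : mx_irreducible rG.
Hypothesis diagC : forall j, is_diag_mx (rG (c j)).

Let t j r := rG (c j) r r.
Let S r := [set j | t j r == -1].

Lemma torus_repr (s : seq I) (e : I -> nat) :
  (\prod_(j <- s) c j ^+ e j)%g \in H /\
  rG (\prod_(j <- s) c j ^+ e j)%g =
    diag_mx (\row_r \prod_(j <- s) t j r ^+ e j).
Proof.
elim: s => [|j s [Hs IHs]].
  rewrite !big_nil group1 repr_mx1; split=> //; apply/matrixP=> r r'.
  by rewrite !mxE big_nil.
rewrite !big_cons; split; first by rewrite groupM ?groupX.
rewrite repr_mxM ?groupX // IHs.
have -> k : rG (c j ^+ k)%g = diag_mx (\row_r t j r ^+ k).
  elim: k => [|k IHk].
    by rewrite repr_mx1; apply/matrixP=> r r'; rewrite !mxE expr0.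
  rewrite expgS repr_mxM ?groupX // IHk; apply/matrixP=> r r'.
  rewrite mul_mx_diag !mxE; case: eqVneq => [-> | ne_r];
    first by rewrite -exprS.
  by move/is_diag_mxP: (diagC j) => ->; rewrite ?mul0r.
apply/matrixP=> r r'; rewrite mul_mx_diag !mxE big_cons.
by case: eqP => [-> | _]; rewrite ?mul0r.
Qed.

Lemma weight_root j r : t j r ^+ o = 1.
Proof.
have [_] := torus_repr [:: j] (fun=> o).
rewrite big_seq1 c_o repr_mx1 => /matrixP/(_ r r).
by rewrite !mxE big_seq1 eqxx.
Qed.

Lemma weight_neq0 j r : t j r != 0.
Proof.
apply: contraTneq (oner_neq0 algC) => t0.
by rewrite -(weight_root j r) t0 expr0n gtn_eqF ?eqxx.
Qed.

Lemma weight_expV j r : t j r ^+ o.-1 = (t j r)^-1.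
Proof.
apply: (mulfI (weight_neq0 j r)).
by rewrite -exprS prednK // weight_root divff ?weight_neq0.
Qed.

(** Compare the entries at [(r, s)] of the two sides of [cJ] and cancel [rG x r s]. *)
Lemma weight_pi x r s j : x \in H -> rG x r s != 0 ->
  t (pi x j) r = if sg x j then (t j s)^-1 else t j s.
Proof.
move=> Hx nz_x; set e := if sg x j then o.-1 else 1%N.
suffices ->: t j s = t (pi x j) r ^+ e.
  by rewrite /e; case: (sg x j); rewrite ?expr1 // weight_expV invrK.
apply: (mulfI nz_x).
have [HT DT] := torus_repr [:: pi x j] (fun=> e).
have [Hc Dc] := torus_repr [:: j] (fun=> 1%N).
rewrite !big_seq1 expg1 in HT DT Hc Dc.
have /matrixP/(_ r s) := congr1 rG (cJ Hx j).
rewrite !repr_mxM // Dc DT mul_mx_diag mul_diag_mx !mxE !big_seq1 expr1.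
by move=> ->; rewrite mulrC.
Qed.

(** Since -1 is its own inverse, the inversions in [weight_pi] do not affect the sets [S]. *)
Lemma support_pi x r s : x \in H -> rG x r s != 0 -> pi x @: S s = S r.
Proof.
move=> Hx nz_x; have inS j : (pi x j \in S r) = (j \in S s).
  rewrite !inE (weight_pi _ Hx nz_x); case: (sg x j) => //.
  by rewrite (can2_eq (@invrK _) (@invrK _)) invrN1.
have [f fK piK] := injF_bij (pi_inj Hx).
apply/setP=> k; rewrite -(piK k) mem_imset ?inS //; exact: pi_inj Hx.
Qed.

Lemma diag_coef_torus x e r : x \in H ->
  rG (x * \prod_j c j ^+ e j)%g r r = rG x r r * \prod_j t j r ^+ e j.
Proof.
move=> Hx; have [HT DT] := torus_repr (index_enum I) e.
by rewrite repr_mxM // DT mul_mx_diag !mxE.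
Qed.

(* On the diagonal, [u := \prod_(j notin S r) (1 + t j r)] is nonzero and
   invariant under [pi x]; this shows that the weights outside [S r] do not
   contribute. *)
Lemma diag_coef_sign x r : x \in H ->
  rG (x * \prod_j c j ^+ (if sg x j then o.-1 else 0%N))%g r r =
    (-1) ^+ #|[set j in S r | sg x j]| * rG x r r.
Proof.
move=> Hx; rewrite diag_coef_torus // [RHS]mulrC.
have [-> | nz_x] := eqVneq (rG x r r) 0; first by rewrite !mul0r.
congr (_ * _); rewrite (bigID (mem (S r))) /=.
rewrite [X in X * _](_ : _ = (-1) ^+ #|[set j in S r | sg x j]|).
  rewrite [X in _ * X](_ : _ = 1) ?mulr1 //.
  have nz_u: \prod_(j | j \notin S r) (1 + t j r) != 0.
    apply/prodf_neq0=> j; rewrite inE; apply: contra.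
    by rewrite addrC addr_eq0.
  apply: (mulfI nz_u); rewrite mulr1.
  have piS j : (pi x j \in S r) = (j \in S r).
    by rewrite -{1}(support_pi Hx nz_x) mem_imset //; exact: pi_inj Hx.
  rewrite -big_split [RHS](reindex (pi x)) /=;
    last exact/onW_bij/injF_bij/(pi_inj Hx).
  apply: eq_big => [j | j _]; first by rewrite piS.
  rewrite (weight_pi _ Hx nz_x); case: (sg x j); last by rewrite expr0 mulr1.
  by rewrite weight_expV mulrDl mul1r divff ?weight_neq0 // addrC.
rewrite -prodr_const big_mkcond [RHS]big_mkcond; apply: eq_bigr => j _.
rewrite !inE; case: eqP => //= tN1; case: (sg x j) => //.
by rewrite weight_expV tN1 invrN1.
Qed.

Definition trace_part (A : {set I}) x := \sum_(r | S r == A) rG x r r.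

(** The projection onto the span of the basis vectors with [S r = A]. *)
Let E (A : {set I}) : 'M[algC]_n := diag_mx (\row_r (S r == A)%:R).

Lemma trace_partE A x : trace_part A x = \tr (E A *m rG x).
Proof.
rewrite /trace_part big_mkcond; apply: eq_bigr => r _.
by rewrite mul_diag_mx !mxE; case: eqP; rewrite ?mul1r ?mul0r.
Qed.

Lemma part_proj A : E A *m E A = E A.
Proof.
apply/matrixP=> r s; rewrite mul_diag_mx !mxE.
by case: (S r == A); rewrite ?mul1r // mul0r mul0rn.
Qed.

Lemma part_comm (A : {set I}) x : x \in H -> pi x @: A = A -> E A *m rG x = rG x
  *m E A.
Proof.
move=> Hx piA; apply/matrixP=> r s; rewrite mul_diag_mx mul_mx_diag !mxE.
have [-> | nz_x] := eqVneq (rG x r s) 0; first by rewrite mulr0 mul0r.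
rewrite mulrC -(support_pi Hx nz_x) -{1}piA (inj_eq (imset_inj _)) //.
exact: pi_inj Hx.
Qed.

Lemma part_move (A : {set I}) x : x \in H -> pi x @: A != A -> E A *m rG x *m E
  A = 0.
Proof.
move=> Hx piA; apply/matrixP=> r s; rewrite mul_mx_diag mul_diag_mx !mxE.
have [-> | nz_x] := eqVneq (rG x r s) 0; first by rewrite mulr0 mul0r.
case: eqP => [Sr | _]; last by rewrite !mul0r.
case: eqP => [Ss | _]; last by rewrite mulr0.
by case/eqP: piA; rewrite -[in LHS]Ss (support_pi Hx nz_x).
Qed.

Lemma trace_part_conj (A : {set I}) x g : x \in H -> g \in H -> pi g @: A = A ->
  trace_part A (x ^ g)%g = trace_part A x.
Proof.
move=> Hx Hg piA; rewrite !trace_partE conjgE !repr_mxM ?groupM ?groupV //.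
rewrite !mulmxA mxtrace_mulC !mulmxA -(part_comm Hg piA) -!mulmxA.
by rewrite (mulmxA (rG g)) -repr_mxM ?groupV // mulgV repr_mx1 mul1mx.
Qed.

(** By Schur's lemma the sum [Z] of the conjugates of [E A *m rG x] is scalar, and it is zero
    because its trace is a multiple of [trace_part A x]. In the trace of [Z *m E A *m rG y] only the
    [g] that stabilise [A] contribute, and each contributes the same value
    [trace_part A (x * y)]. *)
Lemma trace_part_prod (A : {set I}) x y : x \in H -> y \in H -> pi x @: A = A ->
    (forall g, g \in H -> pi g @: A = A ->
      trace_part A (x ^ g * y)%g = trace_part A (x * y)%g) ->
  trace_part A x = 0 -> trace_part A (x * y)%g = 0.
Proof.
move=> Hx Hy piA trJ tr_x0.
pose Z := \sum_(g in H) rG g^-1%g *m (E A *m rG x) *m rG g.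
have [a DZ]: exists a, Z = a%:M.
  apply/is_scalar_mxP/(mx_abs_irr_cent_scalar (groupC irrG))/centgmxP => h Hh.
  rewrite mulmx_suml mulmx_sumr [RHS](reindex_inj (mulIg h)) /=.
  apply: eq_big => [g | g Hg]; first by rewrite groupMr.
  rewrite invMg (repr_mxM _ Hg Hh) (repr_mxM _ (groupVr Hh) (groupVr Hg)).
  by rewrite !mulmxA repr_mxV // mulmxV ?repr_mx_unit // mul1mx.
have n_gt0 : (0 < n)%N by case/mx_irrP: irrG.
have a0 : a = 0.
  have : \tr Z = a *+ n by rewrite DZ mxtrace_scalar.
  rewrite raddf_sum /= big1 => [/esym/eqP | g Hg].
    by rewrite mulrn_eq0 gtn_eqF // => /eqP.
  rewrite mxtrace_mulC mulmxA -repr_mxM ?groupV // mulgV repr_mx1 mul1mx.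
  by rewrite -trace_partE.
have: \tr (Z *m E A *m rG y) = 0 by rewrite DZ a0 raddf0 !mul0mx mxtrace0.
rewrite !mulmx_suml raddf_sum /= (bigID (fun g => pi g @: A == A)) /=.
rewrite [X in _ + X]big1 ?addr0 => [|g /andP[Hg piAg]]; last first.
  rewrite (part_comm Hx piA) -!mulmxA (mulmxA (rG g)) (mulmxA (E A)).
  by rewrite (mulmxA (E A)) (part_move Hg piAg) mul0mx !mulmx0 mxtrace0.
rewrite (eq_bigr (fun=> trace_part A (x * y)%g)) => [|g /andP[Hg /eqP piAg]].
  rewrite sumr_const => /eqP; rewrite mulrn_eq0 => /orP[|/eqP //].
  (* The number of contributing [g] is nonzero, since [x] itself stabilises [A]. *)
  by move/eqP/card0_eq/(_ x); rewrite !inE unfold_in Hx piA eqxx.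
rewrite -(trJ g) // trace_partE.
have EgV: rG g^-1%g *m E A = E A *m rG g^-1%g.
  rewrite -[LHS](repr_mxK rG Hg) -(mulmxA (rG g^-1%g)) (part_comm Hg piAg).
  by rewrite mulmxA -repr_mxM ?groupV // mulVg repr_mx1 mul1mx repr_mxV.
rewrite -!mulmxA (mulmxA (rG g)) -(part_comm Hg piAg) -!mulmxA.
rewrite (mulmxA (rG x)) -(part_comm Hx piA) -!mulmxA (mulmxA (E A) (E A)).
rewrite part_proj (mulmxA (rG g^-1%g)) EgV -!mulmxA -!repr_mxM ?groupM ?groupV
  //.
by rewrite conjgE !mulgA.
Qed.

Variable B : 'M[algC]_n.
Hypothesis uB : B \in unitmx.
Hypothesis BP : {in H, forall x, rG (delta x) *m B = B *m rG (sigma x)}.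

(** A nonzero entry [B r s] forces [t j r = t j s ^+ P] for all [j]; as [P] and its inverse [P'] are
    odd, -1 then occurs at [r] exactly where it occurs at [s]. *)
Lemma part_intertwine (A : {set I}) : E A *m B = B *m E A.
Proof.
apply/matrixP=> r s; rewrite mul_diag_mx mul_mx_diag !mxE mulrC.
have [-> | nzB] := eqVneq (B r s) 0; first by rewrite !mul0r.
suffices ->: S r = S s by [].
have t_rs j : t j r = t j s ^+ P.
  have /matrixP/(_ r s) := BP (cH j); rewrite delta_c sigma_c.
  have [_ D1] := torus_repr [:: j] (fun=> 1%N).
  have [_ DP] := torus_repr [:: j] (fun=> P).
  rewrite big_seq1 expg1 in D1; rewrite big_seq1 in DP.
  rewrite D1 DP mul_diag_mx mul_mx_diag !mxE !big_seq1 expr1 mulrC.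
  exact: mulfI.
have tPP' j : (t j s ^+ P) ^+ P' = t j s.
  have [_ D1] := torus_repr [:: j] (fun=> 1%N).
  have [_ DP] := torus_repr [:: j] (fun=> (P * P')%N).
  rewrite !big_seq1 expg1 PP' in D1 DP.
  have /matrixP/(_ s s) := etrans (esym DP) D1.
  by rewrite !mxE eqxx !big_seq1 expr1 exprM.
apply/setP=> j; rewrite !inE t_rs; apply/eqP/eqP=> [tN1 | ->].
  by rewrite -tPP' tN1 -signr_odd oddP'.
by rewrite -signr_odd oddP.
Qed.

Lemma trace_part_intertwine A x : x \in H ->
  trace_part A (delta x) = trace_part A (sigma x).
Proof.
move=> Hx; rewrite !trace_partE -[rG (delta x)](mulmxK uB) (BP Hx).
by rewrite !mulmxA part_intertwine mxtrace_mulC !mulmxA mulVmx ?mul1mx.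
Qed.

Lemma trace_part_delta (A : {set I}) x : x \in H -> pi x @: A = A ->
  trace_part A (delta x) = (-1) ^+ #|[set j in A | sg x j]| * trace_part A x.
Proof.
move=> Hx piA; rewrite /trace_part big_distrr; apply: eq_bigr => r /eqP Sr.
by rewrite deltaE // diag_coef_sign // Sr.
Qed.

(** The torus factor of [sigma x] consists of even powers of [c j] with [j] in [A], which act as 1
    on the basis vectors concerned. *)
Lemma trace_part_sigma A x : x \in part A ->
  trace_part A (sigma x) = trace_part A x.
Proof.
move=> Ax; have [m m0 ->] := sigmaE Ax.
apply: eq_bigr => r /eqP Sr; rewrite diag_coef_torus ?(part_sub Ax) //.
rewrite big1 ?mulr1 // => j _; have [Aj | nAj] := boolP (j \in A).
  move: Aj; rewrite -Sr inE => /eqP ->.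
  by rewrite -signr_odd odd_double.
by rewrite m0 ?inE // expr0.
Qed.

(** For the component [x1] of [x] on [A], [delta] changes the sign of the A-part, [sigma] preserves
    it, and the two results agree; so the A-part vanishes at [x1], and [trace_part_prod] carries
    this to [x]. *)
Lemma trace_part_odd (A : {set I}) x : x \in H -> pi x @: A = A ->
  odd #|[set j in A | sg x j]| -> trace_part A x = 0.
Proof.
move=> Hx piA odd_x; have [x1 [x2 [Ax1 Ax2 Dx sg_x]]] := part_split Hx piA.
have [Hx1 Hx2] := (part_sub Ax1, part_sub Ax2).
rewrite Dx; apply: trace_part_prod => //; first exact: part_stable.
  (* As [g2] commutes with [x1 ^ g1], and [g1] with [x2], the product of [x1 ^ (g1 * g2)] and [x2]
     is the conjugate of [x1 * x2] by [g1]. *)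
  move=> g Hg piAg; have [g1 [g2 [Ag1 Ag2 -> _]]] := part_split Hg piAg.
  have [Hg1 Hg2] := (part_sub Ag1, part_sub Ag2).
  have com_g2: commute g2 (x1 ^ g1)%g.
    have [c1 cx] := (part_cent Ag1 Ag2, part_cent Ax1 Ag2).
    rewrite conjgE; apply: commuteM; last exact: commuteM (commute_sym _) _.
    exact/commuteV/commute_sym.
  rewrite conjgM (conjg_fixP _); last exact/commgP/commute_sym.
  have x2g1: (x2 ^ g1)%g = x2.
    exact/conjg_fixP/commgP/commute_sym/(part_cent Ag1 Ax2).
  rewrite -[in LHS]x2g1 -conjMg trace_part_conj ?groupM //.
  exact: part_stable.
have := trace_part_delta Hx1 (part_stable Ax1).
rewrite trace_part_intertwine // trace_part_sigma //.
have -> : [set j in A | sg x1 j] = [set j in A | sg x j].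
  by apply/setP=> j; rewrite !inE; case: (boolP (j \in A)) => //= /sg_x ->.
rewrite -signr_odd odd_x expr1 mulN1r => /eqP.
by rewrite -addr_eq0 -mulr2n mulrn_eq0 => /eqP.
Qed.

(** Each A-part is treated separately: its sign is 1, or it vanishes by [trace_part_odd], or [x]
    moves [A] and the diagonal entries concerned are all zero. *)
Lemma trace_delta x : x \in H -> \tr (rG (delta x)) = \tr (rG x).
Proof.
move=> Hx.
have trE y : \tr (rG y) = \sum_A trace_part A y.
  by rewrite /mxtrace (partition_big S xpredT).
rewrite !trE; apply: eq_bigr => A _.
have [piA | npiA] := eqVneq (pi x @: A) A.
  rewrite trace_part_delta //; have [ev | od] := boolP
    (odd #|[set j in A | sg x j]|).
    by rewrite trace_part_odd // mulr0.
  by rewrite -signr_odd (negPf od) mul1r.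
have tr0 r : S r == A -> rG x r r = 0.
  move=> /eqP Sr; apply: contraNeq npiA => nz_x.
  by rewrite -Sr (support_pi Hx nz_x).
rewrite /trace_part [RHS]big1 // big1 // => r Sr.
by rewrite deltaE // diag_coef_sign // tr0 // mulr0.
Qed.

End DiagonalRepr.

(** Equality of the twisted characters makes the twisted representations similar, which provides the
    intertwiner [B] of [trace_delta]. *)
Lemma monomial_twist_fixed (eta : 'CF(H)) : eta \in irr H ->
    {in H, forall x, eta (delta x) = eta (sigma x)} ->
  {in H, forall x, eta (delta x) = eta x}.
Proof.
case/irr_reprP=> rG0 irrG0 -> eq_ds x Hx.
have [rG irrG [Drep diagC]] := codiagonal_repr cH cC irrG0.
rewrite -Drep in eq_ds *; have [dH _ _] := deltaP; have [sH _ _] := sigmaP.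
have [] : mx_rsim (twist_repr deltaP rG) (twist_repr sigmaP rG).
  apply: cfRepr_inj; apply/cfun_inP=> y Hy.
  by have := eq_ds y Hy; rewrite !cfunE Hy dH // sH.
move=> B _ uB BP; rewrite !cfunE Hx dH // !mulr1n.
by apply: (trace_delta irrG diagC (B := B)); rewrite // -row_free_unit.
Qed.

End Monomial.

(** * Coordinates of the symplectic space *)

Section Indices.
Variable l : nat.
Local Notation n := (l.+1 + l.+1)%N.

(* The symplectic basis vectors e_i and f_i have indices [vidx i false] and
   [vidx i true]. *)
Definition vidx (i : 'I_l.+1) (b : bool) : 'I_n :=
  if b then rshift l.+1 i else lshift l.+1 i.
Definition idx (k : 'I_n) : 'I_l.+1 :=
  match fintype.split k with inl i => i | inr i => i end.
Definition side (k : 'I_n) : bool :=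
  if fintype.split k is inl _ then false else true.
(** The index of the only basis vector that the symplectic form pairs nontrivially with the [k]-th
    one. *)
Definition bar (k : 'I_n) : 'I_n := vidx (idx k) (~~ side k).

Lemma idx_vidx i b : idx (vidx i b) = i.
Proof.
have vE : vidx i b = unsplit (if b then inr i else inl i) by case: b.
by rewrite /idx vE unsplitK; case: b {vE}.
Qed.

Lemma side_vidx i b : side (vidx i b) = b.
Proof.
have vE : vidx i b = unsplit (if b then inr i else inl i) by case: b.
by rewrite /side vE unsplitK; case: b {vE}.
Qed.

Lemma vidxK k : vidx (idx k) (side k) = k.
Proof.
by rewrite /idx /side -[RHS]splitK; case: (fintype.split k).
Qed.

Lemma eq_idx_side k k' : (k == k') = (idx k == idx k') && (side k == side k').
Proof.
apply/eqP/andP=> [-> // | [/eqP Ei /eqP Es]].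
by rewrite -[k]vidxK Ei Es vidxK.
Qed.

Lemma idx_bar k : idx (bar k) = idx k. Proof. exact: idx_vidx. Qed.
Lemma side_bar k : side (bar k) = ~~ side k. Proof. exact: side_vidx. Qed.

Lemma barK : involutive bar.
Proof. by move=> k; rewrite /bar idx_vidx side_vidx negbK vidxK. Qed.

Lemma eq_idx k k' : idx k = idx k' -> k' = k \/ k' = bar k.
Proof.
move=> eq_i; case: (eqVneq (side k) (side k')) => [eq_s | ne_s].
  by left; rewrite -[k]vidxK eq_i eq_s vidxK.
right; rewrite /bar eq_i -[LHS]vidxK; congr vidx.
by case: (side k) (side k') ne_s => [] [].
Qed.

Lemma sum_idx (R : nmodType) (F : 'I_n -> R) :
  \sum_k F k = \sum_i (F (vidx i false) + F (vidx i true)).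
Proof. by rewrite big_split_ord big_split. Qed.

End Indices.

Arguments vidx {l} i b : simpl never.

Section SymplecticEntries.
Variables (F : fieldType) (l : nat).
Local Notation n := (l.+1 + l.+1)%N.
Local Notation J := (symp_form F l).

Lemma symp_formE (k k' : 'I_n) : J k k' = (-1) ^+ side k *+ (k' == bar k).
Proof.
rewrite eq_idx_side idx_bar side_bar -(vidxK k) -(vidxK k') !idx_vidx
  !side_vidx.
case: (side k); case: (side k'); rewrite /symp_form /vidx.
- by rewrite block_mxEdr mxE andbF.
- by rewrite block_mxEdl !mxE eq_sym andbT expr1 mulNrn.
- by rewrite block_mxEur !mxE eq_sym andbT expr0.
- by rewrite block_mxEul mxE andbF.
Qed.

Lemma mul_symp_form (x y : 'M[F]_n) k k' : (x^T *m J *m y) k k' =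
  \sum_a (-1) ^+ side a * x a k * y (bar a) k'.
Proof.
rewrite -mulmxA mxE; apply: eq_bigr => a _; rewrite !mxE.
rewrite (bigD1 (bar a)) //= big1 => [|b /negPf nb].
  by rewrite symp_formE eqxx addr0 mulrCA mulrA.
by rewrite symp_formE nb mul0r.
Qed.

Lemma simP (c : F) (x : 'M[F]_n) : x^T *m J *m x = c *: J <->
  forall k k', \sum_a (-1) ^+ side a * x a k * x (bar a) k' =
     c * ((-1) ^+ side k *+ (k' == bar k)).
Proof.
split=> [xJx k k' | xJx].
  by rewrite -mul_symp_form xJx mxE symp_formE.
by apply/matrixP=> k k'; rewrite mul_symp_form xJx mxE symp_formE.
Qed.

Lemma SpP (x : 'M[F]_n) : Sp x <->
  forall k k', \sum_a (-1) ^+ side a * x a k * x (bar a) k' =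
     (-1) ^+ side k *+ (k' == bar k).
Proof.
rewrite /Sp /= -[X in _ = X]scale1r simP.
by split=> xJx k k'; rewrite xJx mul1r.
Qed.

Definition dgmx (v : 'I_n -> F) : 'M[F]_n := diag_mx (\row_k v k).

Lemma dgmxE v k k' : dgmx v k k' = v k *+ (k == k').
Proof. by rewrite !mxE. Qed.

Lemma dgmxM v w : dgmx v *m dgmx w = dgmx (fun k => v k * w k).
Proof.
apply/matrixP=> k k'; rewrite mul_diag_mx !mxE.
by case: eqP => [-> // | _]; rewrite mulr0.
Qed.

Lemma eq_dgmx v w : v =1 w -> dgmx v = dgmx w.
Proof. by move=> eq_vw; apply/matrixP=> k k'; rewrite !dgmxE eq_vw. Qed.

Lemma is_diag_dgmx (x : 'M[F]_n) : is_diag_mx x -> x = dgmx (fun k => x k k).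
Proof.
move/is_diag_mxP=> diag_x; apply/matrixP=> k k'; rewrite dgmxE.
by case: eqP => [-> // | /eqP ne_k]; rewrite diag_x.
Qed.

Lemma mul_dgmx v (x : 'M[F]_n) k k' : (dgmx v *m x) k k' = v k * x k k'.
Proof. by rewrite mul_diag_mx !mxE. Qed.

Lemma mul_mx_dgmx v (x : 'M[F]_n) k k' : (x *m dgmx v) k k' = x k k' * v k'.
Proof. by rewrite mul_mx_diag !mxE. Qed.

Lemma dgmx_sim (c : F) v : (forall k, v k * v (bar k) = c) ->
  (dgmx v)^T *m J *m dgmx v = c *: J.
Proof.
move=> vv; apply/matrixP=> k k'; rewrite tr_diag_mx mul_mx_dgmx mul_dgmx.
rewrite [RHS]mxE symp_formE; case: eqP => [-> | _];
  last by rewrite !mulr0 mul0r.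
by rewrite mulrAC vv.
Qed.

Lemma Sp_dgmx v : Sp (dgmx v) <-> forall k, v k * v (bar k) = 1.
Proof.
split=> [Sv k | vv]; last by rewrite /Sp /= (dgmx_sim vv) scale1r.
have /matrixP/(_ k (bar k)) : (dgmx v)^T *m J *m dgmx v = J by [].
rewrite tr_diag_mx mul_mx_dgmx mul_dgmx symp_formE eqxx mulrAC.
by move/(canRL (mulfK _)) => ->; rewrite ?signr_eq0 // divff ?signr_eq0.
Qed.

End SymplecticEntries.

(** * The torus T_0 *)

Section TorusT0.
Import boolp classical_sets topology_structure connected.
Variables (K : closedFieldType) (l : nat).
Local Notation n := (l.+1 + l.+1)%N.

(** A nonzero polynomial over an algebraically closed field has a non-root; here it is the product
    of ['X] and the ['X^k - 1]. *)
Lemma large_order N : exists2 z : K, z != 0 &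
  forall k, (0 < k <= N)%N -> z ^+ k != 1.
Proof.
pose p : {poly K} := 'X * \prod_(k < N) ('X^(k.+1) - 1).
have: p != 0.
  rewrite mulf_neq0 ?polyX_eq0 //; apply/prodf_neq0=> k _.
  by rewrite -size_poly_eq0 size_XnsubC.
case/closed_nonrootP=> z; rewrite rootE hornerM hornerX horner_prod mulf_eq0.
case/norP=> nz_z /prodf_neq0 zN; exists z => // -[//|k] /= ltkN.
have := zN (Ordinal ltkN) isT.
by rewrite !hornerE subr_eq0.
Qed.

(* The diagonal of a regular element of [Tmax] if e = 1, and of an element of
   T_0 on which the weights of T_0 differ if e = 0. *)
Definition regv (z : K) (e : nat) (k : 'I_n) : K :=
  if side k then z ^- (idx k + e) else z ^+ (idx k + e).

Lemma regv_bar z e k : z != 0 -> regv z e k * regv z e (bar k) = 1.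
Proof.
move=> nz_z; rewrite /regv side_bar idx_bar; case: (side k) => /=.
  by rewrite mulVf ?expf_neq0.
by rewrite divff ?expf_neq0.
Qed.

Lemma exp_inj (z : K) N i j : z != 0 ->
    (forall k, (0 < k <= N)%N -> z ^+ k != 1) ->
  (i <= N)%N -> (j <= N)%N -> z ^+ i = z ^+ j -> i = j.
Proof.
move=> nz_z zN; wlog leij : i j / (i <= j)%N => [IH iN jN eq_z | iN jN eq_z].
  by case/orP: (leq_total i j) => [/IH-> // | /IH <-].
apply/eqP; rewrite eqn_leq leij /= leqNgt -subn_gt0; apply/negP=> ji_gt0.
have /zN : (0 < j - i <= N)%N by rewrite ji_gt0 (leq_trans (leq_subr _ _)).
case/eqP; apply: (mulfI (expf_neq0 i nz_z)).
by rewrite -exprD subnKC // mulr1.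
Qed.

Lemma regv_inj z e N (k k' : 'I_n) : z != 0 ->
    (forall k, (0 < k <= N)%N -> z ^+ k != 1) ->
    ((l + e).*2 <= N)%N -> (0 < idx k + e)%N ->
  regv z e k = regv z e k' -> k = k'.
Proof.
move=> nz_z zN leN gt0k; rewrite /regv.
have leI (i : 'I_l.+1) : (i + e <= N)%N.
  apply: leq_trans leN; rewrite -addnn (leq_trans _ (leq_addr _ _)) //.
  by rewrite leq_add2r -ltnS.
have nz_i i : z ^+ i != 0 by rewrite expf_neq0.
(* Entries on opposite sides agree only if this product is 1; its exponent can reach [(l + e).*2],
   hence the bound on [N]. *)
have sum_neq : z ^+ (idx k + e) * z ^+ (idx k' + e) != 1.
  rewrite -exprD zN // addn_gt0 gt0k /= (leq_trans _ leN) // -addnn.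
  by rewrite leq_add // leq_add2r -ltnS.
have same: z ^+ (idx k + e) = z ^+ (idx k' + e) -> side k = side k' -> k = k'.
  move/(exp_inj nz_z zN)=> /(_ (leI _) (leI _))/addIn/val_inj eq_i eq_s.
  by rewrite -[k]vidxK eq_i eq_s vidxK.
case Dk: (side k) same; case Dk': (side k') => same eq_z.
- by apply: same => //; apply: invr_inj.
- by rewrite -eq_z mulfV ?eqxx in sum_neq.
- by rewrite eq_z mulVf ?eqxx in sum_neq.
- exact: same.
Qed.

Definition torus0 : set 'M[K]_n := [set x | exists v, [/\ x = dgmx v,
  forall k, v k * v (bar k) = 1 & forall k, idx k = ord0 -> v k = 1]]%classic.

Lemma x_longE (t : K) k k' : x_long l t k k' =
  (k == k')%:R + t *+ ((k == vidx ord0 false) && (k' == vidx ord0 true)).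
Proof.
rewrite -(vidxK k) -(vidxK k') !eq_idx_side !idx_vidx !side_vidx.
case: (side k); case: (side k'); rewrite /x_long /vidx /= ?andbF ?andbT ?addr0.
- by rewrite block_mxEdr mxE.
- by rewrite block_mxEdl mxE.
- by rewrite block_mxEur !mxE add0r; case: andP; rewrite ?mulr1 ?mulr0.
- by rewrite block_mxEul mxE.
Qed.

Lemma x_opplongE (t : K) k k' : x_opplong l t k k' =
  (k == k')%:R + t *+ ((k == vidx ord0 true) && (k' == vidx ord0 false)).
Proof.
rewrite -(vidxK k) -(vidxK k') !eq_idx_side !idx_vidx !side_vidx.
case: (side k); case: (side k'); rewrite /x_opplong /vidx /= ?andbF ?andbT
  ?addr0.
- by rewrite block_mxEdr mxE.
- by rewrite block_mxEdl !mxE add0r; case: andP; rewrite ?mulr1 ?mulr0.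
- by rewrite block_mxEur mxE.
- by rewrite block_mxEul mxE.
Qed.

Lemma dgmx_comm v (y : 'M[K]_n) : dgmx v *m y = y *m dgmx v <->
  forall k k', y k k' != 0 -> v k = v k'.
Proof.
split=> [/matrixP vy k k' nz_y | vy].
  by have := vy k k'; rewrite mul_dgmx mul_mx_dgmx mulrC => /(mulfI nz_y).
apply/matrixP=> k k'; rewrite mul_dgmx mul_mx_dgmx mulrC.
by have [-> | /vy->] := eqVneq (y k k') 0; rewrite ?mul0r.
Qed.

(** Commuting with a regular element of [Tmax] forces [x] to be diagonal, and commuting with
    [x_long 1] makes its entries at e_0 and f_0 equal. Conversely, the invertible matrices that
    commute with [dgmx v] form a group containing the generators of [LeviC1]. *)
Lemma cent_Levi (x : 'M[K]_n) : mxcent (@Sp K l) (@LeviC1 K l) x <->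
  exists v, [/\ x = dgmx v, forall k, v k * v (bar k) = 1 &
                forall k k', idx k = ord0 -> idx k' = ord0 -> v k = v k'].
Proof.
have genL : ((@Tmax K l) `|` range (@x_long K l) `|` range (@x_opplong K l)
              `<=` @LeviC1 K l)%classic by apply: sub_smallest.
split=> [[Sx xL] | [v [-> vv v0]]].
  have [z nz_z zN] := large_order (l + 1).*2.
  have Dx : x = dgmx (fun k => x k k).
    apply: is_diag_dgmx; apply/is_diag_mxP=> k k'; apply: contraNeq => nz_x.
    have Treg : Tmax (dgmx (regv z 1)).
      split; last exact: diag_mx_is_diag.
      by apply/Sp_dgmx => k0; apply: regv_bar.
    have /esym/dgmx_comm := xL _ (genL _ (or_introl (or_introl Treg))).
    move/(_ k k' nz_x)/(regv_inj nz_z zN) => -> //.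
    by rewrite addn1.
  exists (fun k => x k k); split=> //; first by apply/Sp_dgmx; rewrite -Dx.
  have xe : x (vidx ord0 false) (vidx ord0 false) = x (vidx ord0 true)
    (vidx ord0 true).
    have Lx : LeviC1 (x_long l (1 : K)) by apply: genL; left; right; exists 1.
    have := xL _ Lx; rewrite {1 2}Dx => /dgmx_comm; apply.
    by rewrite x_longE !eqxx eq_idx_side !side_vidx andbF add0r oner_eq0.
  move=> k k' k0 k'0; rewrite -(vidxK k) -(vidxK k') k0 k'0.
  by case: (side k); case: (side k'); rewrite ?xe.
split; first exact/Sp_dgmx.
pose Z := [set y : 'M[K]_n | y \in unitmx /\ dgmx v *m y = y *m dgmx v]%classic.
suffices sLZ : (@LeviC1 K l `<=` Z)%classic by move=> y /sLZ[].
apply: smallest_sub.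
  split=> [|y []//|y y' [Uy yv] [Uy' y'v] | y [Uy yv]]; split.
  - exact: unitmx1.
  - by rewrite mul1mx mulmx1.
  - by rewrite unitmx_mul Uy.
  - by rewrite mulmxA yv -mulmxA y'v mulmxA.
  - by rewrite unitmx_inv.
  by apply: (can_inj (mulKmx Uy)); rewrite mulmxA -yv mulmxK // mulKVmx.
have [_ SU _ _] := @Sp_subgroup K l.
move=> y [[[Sy /is_diag_dgmx Dy] | [t _ <-]] | [t _ <-]]; split.
- exact: SU.
- by rewrite Dy !dgmxM; apply: eq_dgmx => k; rewrite mulrC.
- by rewrite unitmxE det_ublock !det1 mulr1 unitr1.
- apply/dgmx_comm=> k k'; rewrite x_longE; case: (eqVneq k k') => [-> //|_].
  rewrite add0r; case: andP => [[/eqP-> /eqP->] _ | _]; last by rewrite eqxx.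
  by apply: v0; rewrite idx_vidx.
- by rewrite unitmxE det_lblock !det1 mulr1 unitr1.
apply/dgmx_comm=> k k'; rewrite x_opplongE; case: (eqVneq k k') => [-> //|_].
rewrite add0r; case: andP => [[/eqP-> /eqP->] _ | _]; last by rewrite eqxx.
by apply: v0; rewrite idx_vidx.
Qed.

End TorusT0.

(** * Connectedness of rational curves in the Zariski topology *)

Section Zariski.
Import boolp classical_sets topology_structure connected.
Variables (K : closedFieldType) (N : nat).

Lemma zclosed_coord i j (a : K) :
  closed [set y : zmatrix K N | (y : 'M[K]_N) i j = a]%classic.
Proof.
rewrite -[X in closed X]setCK; apply: open_closedC.
exists [set mpoly.mpolyX K (mpoly.mnm1 (mxvec_index i j)) - mpoly.mpolyC (N * N)
  a]%classic.
congr (~` _)%classic; apply/seteqP; split=> y /= => [yij _ ->|/(_ _ erefl)].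
  by rewrite /zeval mpoly.mevalB mpoly.mevalXU mpoly.mevalC mxvecE yij subrr.
by rewrite /zeval mpoly.mevalB mpoly.mevalXU mpoly.mevalC mxvecE => /subr0_eq.
Qed.

(* A curve whose coordinates are regular functions on the principal open
   subset [w != 0] of the affine line. *)
Variables (w : {poly K}) (y : K -> 'M[K]_N).
Hypothesis w_neq0 : w != 0.
Let regular (g : K -> K) := exists p k, forall s, w.[s] != 0 ->
  g s * w.[s] ^+ k = p.[s].
Hypothesis reg_y : forall i j, regular (fun s => y s i j).

Lemma regular_cst a : regular (fun=> a).
Proof. by exists a%:P, 0%N => s _; rewrite hornerC expr0 mulr1. Qed.

Lemma regularM g h : regular g -> regular h -> regular (fun s => g s * h s).
Proof.
case=> [p [k gp]] [q [m hq]]; exists (p * q), (k + m)%N => s ws.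
by rewrite hornerM -gp // -hq // exprD mulrACA.
Qed.

Lemma regularD g h : regular g -> regular h -> regular (fun s => g s + h s).
Proof.
case=> [p [k gp]] [q [m hq]].
exists (p * w ^+ m + q * w ^+ k), (k + m)%N => s ws.
rewrite hornerD !hornerM !horner_exp -gp // -hq // exprD mulrDl mulrA.
by rewrite -[in RHS](mulrA (h s)) [w.[s] ^+ m * _ in RHS]mulrC.
Qed.

Lemma regular_zeval f : regular (fun s => zeval f (y s)).
Proof.
have [p [k Dp]]: regular (fun s => \sum_(m <- mpoly.msupp f)
    mpoly.mcoeff m f * \prod_i (mxvec (y s) 0 i) ^+ mpoly.fun_of_multinom m i).
  elim: (mpoly.msupp f) => [|m ms IH].
    by have [p [k E]] := regular_cst 0; exists p, k => s ws; rewrite big_nil E.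
  have [|p [k E]] := @regularD (fun s => mpoly.mcoeff m f * \prod_i
    (mxvec (y s) 0 i) ^+ mpoly.fun_of_multinom m i) _ _ IH.
    apply: regularM; first exact: regular_cst.
    elim: (index_enum _) => [|i r IHr].
      by have [p [k E]] := regular_cst 1; exists p, k => s ws;
        rewrite big_nil E.
    have [|p [k E]] := @regularM (fun s => mxvec (y s) 0 i ^+
      mpoly.fun_of_multinom m i) _ _ IHr.
      elim: (mpoly.fun_of_multinom m i) => [|d IHd].
        by have [p [k E]] := regular_cst 1; exists p, k => s ws;
          rewrite expr0 E.
      have [|p [k E]] := @regularM (fun s => mxvec (y s) 0 i) _ _ IHd.
        case/mxvec_indexP: i {IHd} => i j; have [p [k E]] := reg_y i j.
        by exists p, k => s ws; rewrite mxvecE E.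
      by exists p, k => s ws; rewrite exprS E.
    by exists p, k => s ws; rewrite big_cons E.
  by exists p, k => s ws; rewrite big_cons E.
by exists p, k => s ws; rewrite /zeval mpoly.mevalE Dp.
Qed.

(** Let [B] be nonempty, open and closed in the curve. If [g] witnesses a point in [B] and [f] a
    point outside, the numerators of [g] and [f] times [w] have a common non-root, which gives a
    point both inside and outside [B]. *)
Lemma curve_connected :
  connected ([set y s | s in [set s | w.[s] != 0]] : set (zmatrix K N))%classic.
Proof.
set Y := image _ _ => B [x Bx] [C [S DC] DB] [C' /closed_openC[S' DC'] DB'].
move: Bx; rewrite [in B x]DB DC => -[[s1 ws1 <-]].
move=> /existsNP[g /not_implyP[Sg gs1]].
have {}DB' : B = (Y `&` zlocus S')%classic by rewrite DB' -[C']setCK DC' setCK.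
rewrite [LHS]DB'.
apply/seteqP; split=> [z [//]|_ [s0 ws0 <-]].
split; first by exists s0.
move=> f S'f; apply: contrapT => fs0.
have [pg [kg Dg]] := regular_zeval g.
have [pf [kf Df]] := regular_zeval f.
have : pg * pf * w != 0.
  rewrite !mulf_neq0 //; apply/eqP=> p0.
    have /eqP := Dg s1 ws1; rewrite p0 horner0 mulf_eq0 expf_eq0 (negPf ws1)
      andbF orbF.
    by move/eqP.
  have /eqP := Df s0 ws0; rewrite p0 horner0 mulf_eq0 expf_eq0 (negPf ws0) andbF
    orbF.
  by move/eqP.
case/closed_nonrootP=> s; rewrite rootE !hornerM !mulf_eq0 !negb_or.
case/andP=> /andP[pgs pfs] ws.
have : (Y `&` ~` zlocus S)%classic (y s).
  split; first by exists s.
  move=> /(_ _ Sg) g0; have := Dg s ws; rewrite g0 mul0r => /esym/eqP.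
  by rewrite (negPf pgs).
rewrite -DC -DB DB' => -[_ /(_ _ S'f) f0].
by have := Df s ws; rewrite f0 mul0r => /esym/eqP; rewrite (negPf pfs).
Qed.

End Zariski.

(** * Identification of the identity component [T0] with [torus0] *)

Section TorusT0.
Import boolp classical_sets topology_structure connected.
Variables (K : closedFieldType) (l : nat).
Local Notation n := (l.+1 + l.+1)%N.

(** By [cent_Levi] the entry at e_0 is 1 or -1 on the centraliser, hence constantly 1 on a connected
    subset containing the identity. Conversely, a rational curve in the centraliser joins the
    identity to any given element of [torus0]. *)
Lemma T0_torus0 : @T0 K l = @torus0 K l.
Proof.
apply/seteqP; split=> x.
  case=> Y [Y1 YC Ycon] Yx; pose e0 := vidx (ord0 : 'I_l.+1) false.
  have CY (y : 'M[K]_n) : Y y -> y e0 e0 = 1 \/ y e0 e0 = -1.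
    move=> /YC/cent_Levi[v [-> vv v0]].
    have /eqP : v e0 ^+ 2 = 1.
      by rewrite expr2 -[RHS](vv e0); congr (_ * _); apply: v0;
        rewrite ?idx_bar idx_vidx.
    rewrite sqrf_eq1 dgmxE eqxx.
    by case/orP=> /eqP; [left | right].
  have Y_e0 (y : 'M[K]_n) : Y y -> y e0 e0 = 1.
    (* In characteristic 2 the two values coincide; otherwise the value 1 defines a subset that is
       both open and closed in [Y]. *)
    have [N11 y_Y | N11] := eqVneq (-1 : K) 1; first by case: (CY y y_Y);
      rewrite ?N11.
    suffices DY : (Y `&` [set y : zmatrix K n | (y : 'M[K]_n) e0 e0 = 1] =
      Y)%classic.
      by rewrite -DY => -[].
    apply: Ycon; first by exists 1%:M; split=> //=; rewrite mxE eqxx.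
      exists (~` [set y : zmatrix K n | (y : 'M[K]_n) e0 e0 = -1])%classic.
        exact/closed_openC/zclosed_coord.
      apply/seteqP; split=> z [Yz /= z1]; split=> //=.
        by rewrite z1 => /eqP; rewrite eq_sym (negPf N11).
      by case: (CY z Yz).
    by exists [set y : zmatrix K n | (y : 'M[K]_n) e0 e0 = 1]%classic => //;
      apply: zclosed_coord.
  have [v [Dx vv v0]] := iffLR (cent_Levi x) (YC _ Yx).
  exists v; split=> // k k0; rewrite (v0 k e0) ?idx_vidx //.
  by have := Y_e0 x Yx; rewrite Dx dgmxE eqxx.
case=> v [-> vv v0].
(* Each coordinate moves along the line from 1 at s = 0 to its value in [v] at s = 1; [w] vanishes
   where one of them does. *)
pose a (i : 'I_l.+1) : {poly K} := 1 + (v (vidx i false) - 1) *: 'X.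
pose w := \prod_i a i.
pose u s k := if side k then (a (idx k)).[s]^-1 else (a (idx k)).[s].
have a0 i : (a i).[0] = 1 by rewrite !hornerE.
have a1 i : (a i).[1] = v (vidx i false).
  by rewrite /a -polyC1 hornerD hornerZ hornerX mulr1 hornerC addrC subrK.
have nz_v k : v k != 0.
  by apply: contra_eq_neq (vv k) => ->; rewrite mul0r eq_sym oner_eq0.
have w_hornerE s : w.[s] = \prod_i (a i).[s] by rewrite horner_prod.
have w_neq0 : w != 0.
  apply/eqP=> w0; have := w_hornerE 0; rewrite w0 horner0 big1 // => /esym/eqP.
  by rewrite oner_eq0.
have as_neq0 s : w.[s] != 0 -> forall i, (a i).[s] != 0.
  by rewrite w_hornerE => /prodf_neq0 ws i; apply: ws.
exists [set dgmx (u s) | s in [set s | w.[s] != 0]]%classic; last first.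
  exists 1; first by rewrite /= w_hornerE; apply/prodf_neq0=> i _; rewrite a1.
  apply: eq_dgmx => k; rewrite /u a1; case Dk: (side k).
    apply: (mulfI (nz_v (vidx (idx k) false))); rewrite divff //.
    by rewrite -[RHS]mulrC -(vv k) /bar Dk.
  by rewrite -Dk vidxK.
split.
- exists 0; first by rewrite /= w_hornerE; apply/prodf_neq0=> i _;
    rewrite a0 oner_eq0.
  apply/matrixP=> k k'; rewrite dgmxE mxE /u a0 invr1.
  by case: (side k).
- move=> _ [s ws <-]; apply/cent_Levi; exists (u s);
    split=> // [k | k k' k0 k'0].
    rewrite /u side_bar idx_bar; case: (side k); rewrite /= ?mulVf ?divff //;
      exact: as_neq0.
  rewrite /u k0 k'0 /a v0 ?idx_vidx // subrr scale0r addr0 hornerC invr1.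
  by case: (side k); case: (side k').
apply: curve_connected => // k k'; have [-> | ne_k] := eqVneq k k'; last first.
  have [p [m E]] := regular_cst w 0.
  by exists p, m => s ws; rewrite dgmxE (negPf ne_k) E.
case Dk: (side k'); last first.
  exists (a (idx k')), 0%N => s _; rewrite dgmxE eqxx /u Dk expr0 mulr1 //.
exists (\prod_(i | i != idx k') a i), 1%N => s ws.
rewrite dgmxE eqxx /u Dk expr1 w_hornerE (bigD1 (idx k')) //= mulKf ?as_neq0 //.
by rewrite horner_prod.
Qed.

End TorusT0.

(** * The normaliser of T_0 *)

Section MonomialSimilitudes.
Variables (F : fieldType) (l : nat).
Local Notation n := (l.+1 + l.+1)%N.
Local Notation J := (symp_form F l).

(* The weight spaces of T_0 outside the plane <e_0, f_0> are lines, which the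
   normaliser permutes. *)
Definition mono (g : 'M[F]_n) :=
  [forall k, (idx k != ord0) ==>
    [exists a, (idx a != ord0) && [forall b, (g b k != 0) ==> (b == a)]]].

(** The permutation of the weight lines induced by [g], extended by the identity to the plane <e_0,
    f_0>. *)
Definition tau (g : 'M[F]_n) (k : 'I_n) : 'I_n :=
  odflt k [pick a | (idx k != ord0) && (g a k != 0)].

Variables (c : F) (g : 'M[F]_n).
Hypotheses (c_neq0 : c != 0) (sim_g : g^T *m J *m g = c *: J) (mono_g : mono g).

Lemma sim_unit : g \in unitmx.
Proof.
have : c *: J \in unitmx by rewrite unitmxZ ?unitfE // symp_form_unit.
by rewrite -sim_g !unitmx_mul => /andP[].
Qed.

Lemma unit_col k : exists a, g a k != 0.
Proof.
apply/existsP; apply: contraT => /existsPn g0.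
have /matrixP/(_ k k) := mulVmx sim_unit.
rewrite !mxE eqxx big1 => [/esym/eqP|a _]; first by rewrite oner_eq0.
by have := g0 a; rewrite negbK => /eqP ->; rewrite mulr0.
Qed.

Lemma tau_inner k : idx k = ord0 -> tau g k = k.
Proof. by rewrite /tau => ->; case: pickP => //= a; rewrite eqxx. Qed.

Lemma tau_supp k : idx k != ord0 -> [/\ g (tau g k) k != 0,
  idx (tau g k) != ord0 & forall a, g a k != 0 -> a = tau g k].
Proof.
move=> k0; have /forall_inP/(_ k k0)/exists_inP[a a0 /forall_inP ga] := mono_g.
have {}ga b : g b k != 0 -> b = a by move/ga/eqP.
rewrite /tau; case: pickP => [b /andP[_ nz_b] | none].
  by split=> //= [|b' /ga->]; rewrite (ga b nz_b).
by have [b nz_b] := unit_col k; have := none b; rewrite k0 nz_b.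
Qed.

Lemma tau_outer k : (idx (tau g k) != ord0) = (idx k != ord0).
Proof.
have [k0 | k0] := eqVneq (idx k) ord0; first by rewrite tau_inner // k0.
by have [] := tau_supp k0.
Qed.

Lemma tau_pair k k' : idx k != ord0 ->
  (-1) ^+ side (tau g k) * g (tau g k) k * g (bar (tau g k)) k' =
    c * ((-1) ^+ side k *+ (k' == bar k)).
Proof.
move=> k0; have [_ _ tauP] := tau_supp k0.
rewrite -(iffLR (simP c g) sim_g) (bigD1 (tau g k)) //= big1 ?addr0 // => a.
by apply: contraNeq; rewrite !mulf_eq0 !negb_or => /andP[/andP[_ /tauP->]].
Qed.

Lemma tau_bar k : tau g (bar k) = bar (tau g k).
Proof.
have [k0 | k0] := eqVneq (idx k) ord0.
  by rewrite !tau_inner ?idx_bar.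
have bk0 : idx (bar k) != ord0 by rewrite idx_bar.
have [_ _ tauP] := tau_supp bk0; apply/esym/tauP.
apply: contra_eq_neq (tau_pair (bar k) k0) => ->.
by rewrite mulr0 eqxx eq_sym mulf_neq0 // mulr1n signr_eq0.
Qed.

(** The similitude equation for the column [bar k] has a single term, which involves the row
    [tau g k], and its right-hand side vanishes unless [k' = k]. *)
Lemma tau_row k k' : idx k != ord0 -> g (tau g k) k' != 0 -> k' = k.
Proof.
rewrite -[k]barK; set h := bar k; rewrite idx_bar => h0 nz_g.
have := tau_pair k' h0; rewrite -tau_bar; case: eqP => // _.
have [nz_h _ _] := tau_supp h0.
by rewrite mulr0n mulr0 => /eqP; rewrite !mulf_eq0 signr_eq0 (negPf nz_h)
  (negPf nz_g).
Qed.

Lemma tau_inj : injective (tau g).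
Proof.
move=> k k' eq_t; have := tau_outer k'; rewrite -eq_t tau_outer.
have [k0 /esym/negbT | k0 /esym k'0] := eqVneq (idx k) ord0.
  by rewrite negbK => /eqP k'0; rewrite !tau_inner in eq_t.
by apply: (tau_row k'0); have [] := tau_supp k0; rewrite eq_t.
Qed.

(** For [k] in the plane and [a] outside it, [a] is the image under the permutation [tau g] of an
    index outside the plane, so that [tau_row] applies. *)
Lemma mono_supp a k : g a k != 0 ->
  a = tau g k \/ idx a = ord0 /\ idx k = ord0.
Proof.
move=> nz_g; have [k0 | k0] := eqVneq (idx k) ord0; last first.
  by left; have [_ _] := tau_supp k0; apply.
have [a0 | a0] := eqVneq (idx a) ord0; first by right.
have [f fK Kf] := injF_bij tau_inj.
have fa0 : idx (f a) != ord0 by rewrite -tau_outer Kf.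
by rewrite -{1}(Kf a) in nz_g; left; rewrite (tau_row fa0 nz_g) Kf.
Qed.

Lemma mono_inner a k : g a k != 0 -> (idx a == ord0) = (idx k == ord0).
Proof.
case/mono_supp=> [-> | [-> ->]] //.
by apply: negb_inj; rewrite tau_outer.
Qed.

End MonomialSimilitudes.

Section Normaliser.
Import boolp classical_sets topology_structure connected.
Variables (K : closedFieldType) (l : nat).
Local Notation n := (l.+1 + l.+1)%N.
Local Notation J := (symp_form K l).

(** Conjugation by [g] permutes the diagonal entries along [tau g]; the block of [g] on <e_0, f_0>
    has no effect, as [torus0] is trivial there. *)
Lemma sim_mono_norm (c : K) (g : 'M[K]_n) : c != 0 -> g^T *m J *m g = c *: J ->
  mono g -> mxconj g (@torus0 K l) = @torus0 K l.
Proof.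
move=> nz_c sim_g mono_g; have ug := sim_unit nz_c sim_g.
have conjE v v' : (forall k, v' (tau g k) = v k) ->
    (forall k, idx k = ord0 -> v k = 1) ->
    g *m dgmx v *m invmx g = dgmx v'.
  move=> v'E v0; apply: (can_inj (mulmxK ug)); rewrite mulmxKV //.
  apply/matrixP=> a k; rewrite mul_mx_dgmx mul_dgmx mulrC.
  have [-> | nz_g] := eqVneq (g a k) 0; first by rewrite !mulr0.
  case: (mono_supp nz_c sim_g mono_g nz_g) => [-> | [a0 k0]];
    first by rewrite v'E.
  by rewrite -(tau_inner g a0) v'E !v0.
have tbar := tau_bar nz_c sim_g mono_g.
have [f fK Kf] := injF_bij (tau_inj nz_c sim_g mono_g).
apply/seteqP; split=> [_ [_ [v [-> vv v0]] <-] | _ [v [-> vv v0]]].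
  exists (v \o f); split=> [|k|k k0] /=; first by apply: conjE => // k;
    rewrite /= fK.
    have -> : f (bar k) = bar (f k) by rewrite -{1}(Kf k) -tbar fK.
    exact: vv.
  by apply: v0; rewrite -(tau_inner g k0) fK.
exists (dgmx (v \o tau g)).
  exists (v \o tau g); split=> // [k|k k0] /=; first by rewrite tbar vv.
  by rewrite tau_inner // v0.
by apply: conjE => // k k0; rewrite /= tau_inner // v0.
Qed.

(** Take [t] in T_0 whose entries outside the plane differ from all its other entries. Since [g]
    conjugates it to some diagonal [v], [g a k != 0] forces [t k = v a], so a row that meets a
    column outside the plane has no other nonzero entry. *)
Lemma norm_mono (g : 'M[K]_n) : g \in unitmx ->
  mxconj g (@torus0 K l) = @torus0 K l -> mono g.
Proof.
move=> ug norm_g; have [z nz_z zN] := large_order K (l + 0).*2.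
pose t := regv z 0 : 'I_n -> K.
have Tt : torus0 (dgmx t).
  exists t; split=> // k; first exact: regv_bar.
  by rewrite /t /regv addn0 => ->; rewrite expr0 invr1 if_same.
have [v [Dv vv v0]] : torus0 (g *m dgmx t *m invmx g).
  by rewrite -norm_g; exists (dgmx t).
have gE a k : g a k != 0 -> t k = v a.
  move=> nz_g; have /matrixP/(_ a k) : g *m dgmx t = dgmx v *m g.
    by rewrite -Dv mulmxKV.
  by rewrite mul_mx_dgmx mul_dgmx mulrC => /(mulIf nz_g).
have t_inj k k' : idx k != ord0 -> t k = t k' -> k = k'.
  by move=> k0; apply: (regv_inj nz_z zN) => //; rewrite addn0 lt0n.
apply/forall_inP=> k k0; have [a nz_a] : exists a, g a k != 0.
  apply/existsP; apply: contraT => /existsPn g0.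
  have /matrixP/(_ k k) := mulVmx ug.
  rewrite !mxE eqxx big1 => [/esym/eqP|a _]; first by rewrite oner_eq0.
  by have := g0 a; rewrite negbK => /eqP ->; rewrite mulr0.
have row_a b k' : g b k != 0 -> g b k' != 0 -> k' = k.
  by move=> nz nz'; apply/esym/t_inj; rewrite // (gE b k') // (gE b k).
apply/exists_inP; exists a.
  apply/eqP=> a0; have := gE _ _ nz_a; rewrite v0 // => tk1.
  have t01 : t (vidx ord0 false) = 1 by rewrite /t /regv side_vidx idx_vidx
    expr0.
  by case/eqP: (k0); rewrite (t_inj k (vidx ord0 false)) ?idx_vidx // t01.
apply/forall_inP=> b nz_b.
(* The sum for the entry [(d, a)] of [g *m invmx g] thus reduces to one term, which excludes a
   second nonzero entry in the column [k]. *)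
have gg d : g d k != 0 -> g d k * invmx g k a = (d == a)%:R.
  move=> nz_d; have /matrixP/(_ d a) := mulmxV ug; rewrite !mxE => <-.
  rewrite (bigD1 k) //= big1 ?addr0 // => k' ne_k.
  by apply: contraNeq ne_k; rewrite mulf_eq0 negb_or =>
    /andP[/(row_a _ _ nz_d)-> _].
have nz_inv : invmx g k a != 0.
  by apply: contra_eq_neq (gg a nz_a) => ->;
    rewrite mulr0 eqxx eq_sym oner_neq0.
have := gg b nz_b; case: eqP => // _ /eqP.
by rewrite mulf_eq0 (negPf nz_b) (negPf nz_inv).
Qed.

End Normaliser.

Section FiniteNormaliser.
Import boolp classical_sets topology_structure connected.
Variables (p m l : nat) (p_pr : prime p).
Variables (Fq : finFieldType) (cardFq : #|Fq| = (p ^ m)%N).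
Variables (K : closedFieldType) (iota : {rmorphism Fq -> K}).
Local Notation n := (l.+1 + l.+1)%N.
Local Notation GLq := {'GL_n[Fq]}.

Lemma mono_GLmx (g : GLq) : mono (GLmx iota g) = mono (GLval g).
Proof.
apply: eq_forallb => k; congr (_ ==> _); apply: eq_existsb => a.
by congr (_ && _); apply: eq_forallb => b; rewrite mxE fmorph_eq0.
Qed.

(** Normalising T_0, a condition over [K], only depends on the positions of the zero entries and is
    thus read off over [Fq]. *)
Lemma mem_tNq (g : GLq) : (g \in tNq l iota) = (g \in tGq l iota) && mono
  (GLval g).
Proof.
rewrite inE; apply: andb_id2l; rewrite mem_tGq =>
  /existsP[c /andP[nz_c /eqP sim_g]].
rewrite T0_torus0 -mono_GLmx; apply/asboolP/idP => [|mono_g].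
  exact/norm_mono/GLmx_unit.
apply: (@sim_mono_norm _ _ (iota c)) => //; first by rewrite fmorph_eq0.
by rewrite -(map_symp_form l iota) /GLmx map_trmx -!map_mxM sim_g map_mxZ.
Qed.

Lemma Gq_sub_tGq : {subset Gq l iota <= tGq l iota}.
Proof.
move=> g; rewrite mem_Gq mem_tGq => Sg; apply/existsP; exists 1.
by rewrite oner_eq0 scale1r.
Qed.

Lemma mem_Nq (g : GLq) : (g \in Nq l iota) = (g \in Gq l iota) && mono
  (GLval g).
Proof.
rewrite inE; apply: andb_id2l => Gg; have := mem_tNq g.
by rewrite inE Gq_sub_tGq.
Qed.

End FiniteNormaliser.

(** * Matrices supported on a set of coordinate planes *)

Section Support.
Variables (F : fieldType) (l : nat).
Local Notation n := (l.+1 + l.+1)%N.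
Local Notation J := (symp_form F l).
Implicit Types (R : {set 'I_l.+1}) (x y : 'M[F]_n).

Definition supp R x :=
  [forall k, forall k', (idx k \in R) && (idx k' \in R) ||
    (x k k' == (k == k')%:R)].

Lemma suppP R x : reflect
  (forall k k', ~~ ((idx k \in R) && (idx k' \in R)) -> x k k' = (k == k')%:R)
  (supp R x).
Proof.
apply: (iffP forallP) => [Rx k k' /negPf nR | Rx k].
  by have /forallP/(_ k') := Rx k; rewrite nR => /eqP.
by apply/forallP=> k'; case: (boolP (_ && _)) => //= /Rx->.
Qed.

Definition preserves R x :=
  forall k k', x k k' != 0 -> (idx k \in R) = (idx k' \in R).

Definition res R x : 'M[F]_n := \matrix_(k, k')
  if (idx k \in R) && (idx k' \in R) then x k k' else (k == k')%:R.

Lemma supp_res R x : supp R (res R x).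
Proof. by apply/suppP=> k k' /negPf nR; rewrite mxE nR. Qed.

Lemma suppS R R' x : R \subset R' -> supp R x -> supp R' x.
Proof.
move=> sR /suppP Rx; apply/suppP=> k k' nR'; apply: Rx; apply: contra nR'.
by case/andP=> /(subsetP sR)-> /(subsetP sR)->.
Qed.

Lemma suppI R R' x : supp R x -> supp R' x -> supp (R :&: R') x.
Proof.
move=> /suppP Rx /suppP R'x; apply/suppP=> k k'; rewrite !inE andbACA negb_and.
by case/orP=> [/Rx | /R'x].
Qed.

Lemma supp_preserves R x : supp R x -> preserves R x.
Proof.
move/suppP=> Rx k k'; have [/andP[-> ->] // | nR] := boolP
  ((idx k \in R) && (idx k' \in R)).
by rewrite Rx //; case: (eqVneq k k') => [-> // | _]; rewrite eqxx.
Qed.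

Lemma supp_neq R x k k' : supp R x ->
  (idx k \in R) != (idx k' \in R) -> x k k' = 0.
Proof. by move=> /supp_preserves xR; apply: contraNeq => /xR->. Qed.

Lemma mul_supp R x y k k' : supp R x -> supp (~: R) y ->
  (x *m y) k k' = if idx k \in R then x k k' else y k k'.
Proof.
move=> Rx Ry; have [/suppP xE /suppP yE] := (Rx, Ry).
rewrite mxE; case: ifP => kR.
  rewrite (bigD1 k') //= big1 ?addr0 => [|a ak'].
    have [k'R | k'R] := boolP (idx k' \in R);
      first by rewrite yE ?eqxx ?mulr1 // inE k'R.
    by rewrite (supp_neq Rx) ?mul0r // kR (negPf k'R).
  have [aR | aR] := boolP (idx a \in R).
    by rewrite yE ?(negPf ak') ?mulr0 // inE aR.
  by rewrite (supp_neq Rx) ?mul0r // kR (negPf aR).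
rewrite (bigD1 k) //= big1 ?addr0 => [|a ak].
  by rewrite xE ?kR // eqxx mul1r.
by rewrite xE ?kR // eq_sym (negPf ak) mul0r.
Qed.

Lemma mul_suppC R x y k k' : supp R x -> supp (~: R) y ->
  (y *m x) k k' = if idx k \in R then x k k' else y k k'.
Proof.
rewrite -{1}[R]setCK => Rx Ry; rewrite (mul_supp _ _ Ry Rx) inE.
by case: (idx k \in R).
Qed.

Lemma supp_comm R x y : supp R x -> supp (~: R) y -> x *m y = y *m x.
Proof.
by move=> Rx Ry; apply/matrixP=> k k';
  rewrite (mul_supp _ _ Rx Ry) (mul_suppC _ _ Rx Ry).
Qed.

Lemma res_split R x : preserves R x -> x = res R x *m res (~: R) x.
Proof.
move=> xR; apply/matrixP=> k k'; rewrite (@mul_supp R) ?supp_res // !mxE !inE.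
have k_k' : (idx k \in R) != (idx k' \in R) -> x k k' = (k == k')%:R.
  case: (eqVneq k k') => [-> | _ nR]; first by rewrite eqxx.
  by apply: contraNeq nR => /xR->.
case: (idx k \in R) k_k'; case: (idx k' \in R) => //= -> //.
Qed.

Lemma res_Sp R x : Sp x -> preserves R x -> Sp (res R x).
Proof.
move=> /SpP Sx xR; apply/SpP=> k k'.
have [kR | kR] := boolP (idx k \in R); last first.
  rewrite (bigD1 k) //= big1 ?addr0 => [|a ak].
    by rewrite !mxE idx_bar (negPf kR) eqxx /= mulr1 mulr_natr eq_sym.
  by rewrite !mxE (negPf kR) andbF (negPf ak) mulr0 mul0r.
have [k'R | k'R] := boolP (idx k' \in R).
  rewrite -Sx; apply: eq_bigr => a _; rewrite !mxE idx_bar kR k'R !andbT.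
  case: (boolP (idx a \in R)) => // aR.
  have -> : x a k = 0 by apply: contraNeq aR => /xR->.
  have /negPf-> : a != k by apply: contraNneq aR => ->.
  by rewrite /= !mulr0 !mul0r.
rewrite big1 => [|a _].
  case: (eqVneq k' (bar k)) k'R => [-> | _ _]; first by rewrite idx_bar kR.
  by rewrite mulr0n.
rewrite !mxE (negPf k'R) andbF kR andbT; case: (eqVneq (bar a) k') => [Da | _].
  move: k'R; rewrite -Da idx_bar => aR; rewrite (negPf aR).
  have /negPf-> : a != k by apply: contraNneq aR => ->.
  by rewrite mulr0 mul0r.
by rewrite mulr0.
Qed.

Lemma res_mono R x : mono x -> preserves R x -> mono (res R x).
Proof.
move=> /forall_inP mono_x xR; apply/forall_inP=> k k0.
have [kR | kR] := boolP (idx k \in R); last first.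
  apply/exists_inP; exists k => //; apply/forall_inP=> b;
    rewrite mxE (negPf kR) andbF.
  by case: (eqVneq b k) => //; rewrite eqxx.
have /exists_inP[a a0 /forall_inP xa] := mono_x k k0.
apply/exists_inP; exists a => //; apply/forall_inP=> b; rewrite mxE kR andbT.
case: ifP => [_ /xa // | bR]; case: (eqVneq b k) bR => [-> | _];
  first by rewrite kR.
by rewrite eqxx.
Qed.

Lemma suppM R x y : supp R x -> supp R y -> supp R (x *m y).
Proof.
move=> /suppP Rx /suppP Ry; apply/suppP=> k k'; rewrite negb_and mxE.
case/orP=> nR.
  rewrite (bigD1 k) //= big1 ?addr0 => [|a ak].
    by rewrite Rx ?(negPf nR) // eqxx mul1r Ry ?(negPf nR).
  by rewrite Rx ?(negPf nR) // eq_sym (negPf ak) mul0r.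
rewrite (bigD1 k') //= big1 ?addr0 => [|a ak].
  by rewrite Ry ?(negPf nR) ?andbF // eqxx mulr1 Rx ?(negPf nR) ?andbF.
by rewrite Ry ?(negPf nR) ?andbF // (negPf ak) mulr0.
Qed.

Lemma supp1 R : supp R 1%:M.
Proof. by apply/suppP=> k k' _; rewrite mxE. Qed.

Lemma supp_set0 x : supp set0 x -> x = 1%:M.
Proof. by move/suppP=> x0; apply/matrixP=> k k'; rewrite x0 ?inE // mxE. Qed.

End Support.

(** * Subgroups of N defined by supports *)

Section Parts.
Variables (l : nat) (Fq : finFieldType) (K : closedFieldType).
Variable iota : {rmorphism Fq -> K}.
Local Notation n := (l.+1 + l.+1)%N.
Local Notation GLq := {'GL_n[Fq]}.
Local Notation J := (symp_form Fq l).
Local Notation N := (Nq_group l iota).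
Implicit Types R : {set 'I_l.+1}.

Definition toGL (x : 'M[Fq]_n) : GLq := insubd (1%g : GLq) x.

Lemma toGLK x : x \in unitmx -> GLval (toGL x) = x.
Proof. exact: (@insubdK _ _ _ (1%g : GLq)). Qed.

Lemma GLval_inj : injective (@GLval n Fq).
Proof. exact: val_inj. Qed.

Lemma memNP (g : GLq) : reflect
  (Sp (GLval g) /\ mono (GLval g)) (g \in N).
Proof.
rewrite [g \in N]mem_Nq mem_Gq.
by apply: (iffP andP) => -[/eqP].
Qed.

Lemma N_inner (g : GLq) : g \in N -> preserves [set ord0] (GLval g).
Proof.
case/memNP=> Sg Mg k k' nz_g; rewrite !inE; move: nz_g.
by apply: (mono_inner (oner_neq0 _)) => //; rewrite scale1r.
Qed.

Definition partN (R : {set 'I_l.+1}) : {set GLq} :=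
  [set g in N | supp R (GLval g)].

Lemma in_partN R g : (g \in partN R) = (g \in N) && supp R (GLval g).
Proof. exact: in_set. Qed.

Lemma partN_group_set R : group_set (partN R).
Proof.
apply/group_setP; split; first by rewrite in_partN group1 supp1.
move=> g h; rewrite !in_partN => /andP[Ng Rg] /andP[Nh Rh].
by rewrite groupM //= suppM.
Qed.
Canonical partN_group R := Group (partN_group_set R).

Lemma partN_sub R : partN R \subset N.
Proof. by apply/subsetP=> g; rewrite in_partN => /andP[]. Qed.

Lemma partNS (R R' : {set 'I_l.+1}) : R \subset R' -> partN R \subset partN R'.
Proof.
move=> sR; apply/subsetP=> g; rewrite !in_partN => /andP[-> Rg].
exact: suppS Rg.
Qed.

Lemma partN_comm R : {in partN R & partN (~: R), forall x y, commute x y}.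
Proof.
move=> x y; rewrite !in_partN => /andP[_ Rx] /andP[_ Ry].
by apply: GLval_inj; apply: supp_comm Rx Ry.
Qed.

Lemma partN_split R g : g \in N -> preserves R (GLval g) ->
  [/\ toGL (res R (GLval g)) \in partN R,
      toGL (res (~: R) (GLval g)) \in partN (~: R) &
      g = (toGL (res R (GLval g)) * toGL (res (~: R) (GLval g)))%g].
Proof.
move=> Ng gR; have [Sg Mg] := memNP _ Ng.
have gR' : preserves (~: R) (GLval g) by move=> k k' /gR; rewrite !inE => ->.
have unit_res R' : preserves R' (GLval g) -> res R' (GLval g) \in unitmx.
  move=> gR''; have [_ SU _ _] := @Sp_subgroup Fq l; apply: SU.
  exact: res_Sp Sg gR''.
have in_part R' : preserves R' (GLval g) -> toGL (res R' (GLval g)) \in partN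
  R'.
  move=> gR''; rewrite in_partN toGLK ?unit_res ?supp_res // andbT.
  by apply/memNP; rewrite toGLK ?unit_res //; split;
    [exact: res_Sp Sg gR'' | exact: res_mono Mg gR''].
split; rewrite ?in_part //; apply: GLval_inj.
by rewrite GL_MxE !toGLK ?unit_res // -res_split.
Qed.

(** Elements of N preserve <e_0, f_0> and the span of the other basis vectors, so they are products
    of their two restrictions. *)
Lemma partN_dprod : partN [set ord0] \x partN (~: [set ord0]) = N.
Proof.
rewrite dprodE.
- apply/setP=> g; apply/mulsgP/idP => [[x y Yx Hy ->] | Ng].
    by rewrite groupM // (subsetP (partN_sub _) _ Yx,
      subsetP (partN_sub _) _ Hy).
  have [Yg Hg Dg] := partN_split Ng (N_inner Ng).
  by exists (toGL (res [set ord0] (GLval g)))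
    (toGL (res (~: [set ord0]) (GLval g))).
- apply/centsP=> x Hx y Yy; exact/esym/(partN_comm Yy Hx).
apply/trivgP/subsetP=> g; rewrite inE !in_partN =>
  /andP[/andP[_ Yg] /andP[_ Hg]].
rewrite inE.
apply/eqP/GLval_inj; have := suppI Yg Hg; rewrite setICr.
exact: supp_set0.
Qed.

End Parts.

(** * Classes of SL_2 *)

Section TwoSquares.
Variable F : finFieldType.
Hypothesis oddF : odd #|F|.

(** The fibres of squaring have at most two elements, and the inequality is strict because [#|F|] is
    odd. *)
Lemma card_squares : (#|F| < #|[set x ^+ 2 | x in F]|.*2)%N.
Proof.
suffices : (#|F| <= #|[set x ^+ 2 | x in F]|.*2)%N.
  by rewrite leq_eqVlt => /orP[/eqP DF|//]; move: oddF; rewrite DF odd_double.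
rewrite -muln2 -sum_nat_const -[leqLHS]sum1_card
  (partition_big_imset (fun x : F => x ^+ 2)) /=;
    apply: leq_sum => _ /imsetP[x _ ->].
rewrite sum1_card; apply: leq_trans (card_size [:: x; - x]).
apply/subset_leq_card/subsetP=> y; 
by rewrite unfold_in !inE -eqf_sqr.
Qed.

(** The squares [A] and the set [B] of the [c - k * a] each fill more than half of the field, so
    they meet. *)
Lemma sum_squares (k c : F) : k != 0 -> exists r t, r ^+ 2 + k * t ^+ 2 = c.
Proof.
move=> nz_k; pose A := [set x ^+ 2 | x in F];
  pose B := [set c - k * a | a in A].
have cardB : #|B| = #|A|.
  by apply: card_imset => a b /addrI/oppr_inj/(mulfI nz_k).
have [/pred0P/(_ _)dAB | ] := boolP [disjoint A & B].
  have := max_card (mem (A :|: B)).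
  rewrite cardsU (_ : A :&: B = set0) ?cards0 ?subn0 ?cardB.
    by rewrite addnn leqNgt card_squares.
  by apply/setP=> x; rewrite !inE; apply: dAB.
case/pred0Pn=> _ /andP[/imsetP[r _ ->] /imsetP[_ /imsetP[t _ ->] Dr]].
by exists r, t; rewrite Dr subrK.
Qed.

End TwoSquares.

(** * SL_2 acting on the plane <e_0, f_0> *)

Section SL2.
Variables (F : fieldType) (l : nat).
Local Notation n := (l.+1 + l.+1)%N.

Definition sl2mx (a b c d : F) : 'M[F]_n := \matrix_(k, k')
  if (idx k == ord0) && (idx k' == ord0) then
    (if side k then (if side k' then d else c) else (if side k' then b else a))
  else (k == k')%:R.

Local Notation e0 := (vidx (ord0 : 'I_l.+1) false).
Local Notation f0 := (vidx (ord0 : 'I_l.+1) true).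

Lemma sl2mxM a b c d a' b' c' d' :
  sl2mx a b c d *m sl2mx a' b' c' d' =
  sl2mx (a * a' + b * c') (a * b' + b * d') (c * a' + d * c') (c * b' + d * d').
Proof.
apply/matrixP=> k k'; rewrite mxE sum_idx (bigD1 ord0) //= !mxE.
rewrite !idx_vidx !side_vidx eqxx !andbT /=.
have [k0 | k0] := eqVneq (idx k) ord0.
  rewrite big1 ?addr0 => [|i i0].
    have [k'0 | k'0] := eqVneq (idx k') ord0; first by case: (side k);
      case: (side k').
    have nk b0 : (vidx ord0 b0 == k') = false.
      by apply: contraNF k'0 => /eqP <-; rewrite idx_vidx.
    have -> : (k == k') = false by apply: contraNF k'0 => /eqP <-; rewrite k0.
    by rewrite !nk !mulr0 addr0.
  rewrite !mxE !idx_vidx k0 (negPf i0) !andbF.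
  have nk b0 : (k == vidx i b0) = false.
    by apply: contraNF i0 => /eqP Dk; rewrite -k0 Dk idx_vidx.
  by rewrite !nk !mul0r addr0.
have nk b0 : (k == vidx ord0 b0) = false.
  by apply: contraNF k0 => /eqP ->; rewrite idx_vidx.
rewrite !nk !mul0r addr0 add0r (bigD1 (idx k)) //= big1 ?addr0 =>
  [|i /andP[_ ik]].
  have := vidxK k; rewrite !mxE !idx_vidx (negPf k0) /=.
  case Dk: (side k) => Ek; rewrite Ek eqxx mul1r.
    by rewrite eq_idx_side side_vidx Dk andbF mul0r add0r.
  by rewrite (eq_idx_side k (vidx _ _)) side_vidx Dk andbF mul0r addr0.
have nki b0 : (k == vidx i b0) = false.
  by apply: contraNF ik => /eqP ->; rewrite idx_vidx.
by rewrite !mxE !nki (negPf k0) /= !mul0r addr0.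
Qed.

Lemma supp_sl2mx a b c d : supp [set ord0] (sl2mx a b c d).
Proof. by apply/suppP=> k k'; rewrite !inE mxE => /negPf->. Qed.

Lemma sl2mxE y : supp [set ord0] y -> y = sl2mx (y e0 e0) (y e0 f0) (y f0 e0)
  (y f0 f0).
Proof.
move/suppP=> Ry; apply/matrixP=> k k'; rewrite mxE.
case: ifP => [/andP[/eqP k0 /eqP k'0] | nk]; last by rewrite Ry // !inE nk.
rewrite -{1}(vidxK k) -{1}(vidxK k') k0 k'0.
by case: (side k); case: (side k').
Qed.

Lemma sl2mx_coef a b c d : [/\ sl2mx a b c d e0 e0 = a, sl2mx a b c d e0 f0 = b,
  sl2mx a b c d f0 e0 = c & sl2mx a b c d f0 f0 = d].
Proof. by split; rewrite mxE !idx_vidx !side_vidx eqxx. Qed.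

Lemma Sp_sl2mx a b c d : Sp (sl2mx a b c d) <-> a * d - b * c = 1.
Proof.
set x := sl2mx a b c d.
have col0 k k' : idx k = ord0 ->
    \sum_a0 (-1) ^+ side a0 * x a0 k * x (bar a0) k' =
    x e0 k * x f0 k' - x f0 k * x e0 k'.
  move=> k0; rewrite sum_idx (bigD1 ord0) //= big1 ?addr0 => [|i i0].
    by rewrite /bar !side_vidx !idx_vidx /= expr0 expr1; ring.
  have x0 s : x (vidx i s) k = 0.
    rewrite mxE idx_vidx (negPf i0) /=; case: eqP => // Dk.
    by rewrite -Dk idx_vidx in k0; rewrite k0 eqxx in i0.
  by rewrite !x0 !mulr0 !mul0r addr0.
have [xa xb xc xd] := sl2mx_coef a b c d; rewrite -/x in xa xb xc xd.
split=> [/SpP/(_ e0 f0) | det1].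
  rewrite col0 ?idx_vidx // xa xb xc xd side_vidx /bar idx_vidx side_vidx eqxx.
  by rewrite expr0 [c * b]mulrC.
apply/SpP=> k k'; have [k0 | k0] := eqVneq (idx k) ord0; last first.
  have xk a0 : x a0 k = (a0 == k)%:R by rewrite mxE (negPf k0) andbF.
  rewrite (bigD1 k) //= big1 ?addr0 => [|a0 ak].
    rewrite xk eqxx mulr1 mxE idx_bar (negPf k0) /=.
    by rewrite mulr_natr eq_sym.
  by rewrite xk (negPf ak) mulr0 mul0r.
rewrite col0 //; have [k'0 | k'0] := eqVneq (idx k') ord0; last first.
  have xk' s : x (vidx ord0 s) k' = 0.
    rewrite mxE (negPf k'0) andbF; case: eqP => // Dk'.
    by rewrite -Dk' idx_vidx eqxx in k'0.
  rewrite !xk' !mulr0 subr0 (_ : _ == _ = false) //.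
  by apply: contraNF k'0 => /eqP->; rewrite idx_bar k0.
rewrite -(vidxK k) -(vidxK k') k0 k'0 /bar !idx_vidx !side_vidx eq_idx_side.
rewrite !idx_vidx !side_vidx eqxx.
case: (side k); case: (side k'); rewrite ?xa ?xb ?xc ?xd /= ?mulr0n ?mulr1n.
- by rewrite mulrC subrr.
- by rewrite expr1 -det1; ring.
- by rewrite expr0 -det1; ring.
- by rewrite mulrC subrr.
Qed.

Lemma sl2mx_mono a b c d : mono (sl2mx a b c d).
Proof.
apply/forall_inP=> k k0; apply/exists_inP; exists k => //.
apply/forall_inP=> b'; rewrite mxE (negPf k0) andbF.
by case: (eqVneq b' k) => //; rewrite eqxx.
Qed.

End SL2.

Section SL2Classes.
Variables (l : nat) (Fq : finFieldType) (K : closedFieldType).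
Variable iota : {rmorphism Fq -> K}.
Local Notation n := (l.+1 + l.+1)%N.
Local Notation GLq := {'GL_n[Fq]}.
Local Notation Y := (partN iota [set ord0 : 'I_l.+1]).

Lemma sl2P (g : GLq) : g \in Y -> exists a b c d,
  GLval g = sl2mx l a b c d /\ a * d - b * c = 1.
Proof.
rewrite in_partN => /andP[/memNP[Sg _] /sl2mxE Dg].
rewrite Dg in Sg; exists (GLval g (vidx ord0 false) (vidx ord0 false)).
do 3!eexists; split; first exact: Dg.
exact/Sp_sl2mx/Sg.
Qed.

Lemma sl2_unit (a b c d : Fq) : a * d - b * c = 1 -> sl2mx l a b c d \in unitmx.
Proof. by move/Sp_sl2mx=> Sx; have [_ SU _ _] := @Sp_subgroup Fq l; apply: SU.
Qed.

Lemma mem_sl2 (a b c d : Fq) : a * d - b * c = 1 -> toGL (sl2mx l a b c d) \in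
  Y.
Proof.
move=> det1; rewrite in_partN toGLK ?sl2_unit // supp_sl2mx andbT.
by apply/memNP; rewrite toGLK ?sl2_unit //; split;
  [apply/Sp_sl2mx | apply: sl2mx_mono].
Qed.

Lemma sl2_conj (y y' : GLq) (p q r s : Fq) : p * s - q * r = 1 ->
    GLval y *m sl2mx l p q r s = sl2mx l p q r s *m GLval y' ->
  y' \in (y ^: Y)%g.
Proof.
move=> det1 eq_yy'; apply/imsetP; exists (toGL (sl2mx l p q r s)).
  exact: mem_sl2.
apply: (mulgI (toGL (sl2mx l p q r s))); rewrite -conjgC; apply: GLval_inj.
by rewrite !GL_MxE !toGLK ?sl2_unit.
Qed.

(** When the lower left entry is nonzero, its square class and the trace determine the class in
    SL_2; the conjugating matrix is triangular. *)
Lemma sl2_lower (a b c d a' b' d' u : Fq) : c != 0 -> u != 0 ->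
    a * d - b * c = 1 -> a' * d' - b' * (c * u ^+ 2) = 1 -> a' + d' = a + d ->
  sl2mx l a b c d *m sl2mx l u ((a - a') / (c * u)) 0 u^-1 =
  sl2mx l u ((a - a') / (c * u)) 0 u^-1 *m sl2mx l a' b' (c * u ^+ 2) d'.
Proof.
move=> nz_c nz_u det1 det1' trE; rewrite !sl2mxM.
have -> : d' = a + d - a' by rewrite -trE addrC addKr.
have -> : b = (a * d - 1) / c.
  by apply: (canRL (mulfK nz_c)); rewrite -det1; ring.
have -> : b' = (a' * (a + d - a') - 1) / (c * u ^+ 2).
  apply: (canRL (mulfK _)); first by rewrite mulf_neq0 ?expf_neq0.
  by rewrite -det1' -trE; ring.
by congr sl2mx; field; rewrite ?nz_c ?nz_u.
Qed.

(** The transposed form of [sl2_lower], applied when c = 0. *)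
Lemma sl2_upper (a b c d a' c' d' u : Fq) : b != 0 -> u != 0 ->
    a * d - b * c = 1 -> a' * d' - (b * u ^+ 2) * c' = 1 -> a' + d' = a + d ->
  sl2mx l a b c d *m sl2mx l u^-1 0 ((d - d') / (b * u)) u =
  sl2mx l u^-1 0 ((d - d') / (b * u)) u *m sl2mx l a' (b * u ^+ 2) c' d'.
Proof.
move=> nz_b nz_u det1 det1' trE; rewrite !sl2mxM.
have -> : a' = a + d - d' by rewrite -trE addrK.
have -> : c = (a * d - 1) / b.
  by apply: (canRL (mulfK nz_b)); rewrite -det1; ring.
have -> : c' = ((a + d - d') * d' - 1) / (b * u ^+ 2).
  apply: (canRL (mulfK _)); first by rewrite mulf_neq0 ?expf_neq0.
  by rewrite -det1' -trE; ring.
by congr sl2mx; field; rewrite ?nz_b ?nz_u.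
Qed.

Hypotheses (oddFq : odd #|Fq|) (two_neq0 : (2 : Fq) != 0).
Variables (gam : Fq) (P : nat).
Hypotheses (gam_neq0 : gam != 0) (oddP : odd P).
Hypothesis frobD : forall x y : Fq, (x + y) ^+ P = x ^+ P + y ^+ P.

(* If the trace [tr] satisfies tr^2 <> 4, the centraliser of y in GL_2 contains
   an element s + t y of determinant gam; otherwise y is, up to sign,
   unipotent, and its class is determined by a square class. *)
Lemma sl2_class (y y1 y2 : GLq) (a b c d : Fq) : a * d - b * c = 1 ->
    GLval y = sl2mx l a b c d ->
    GLval y1 = sl2mx l a (gam * b) (gam^-1 * c) d ->
    GLval y2 = sl2mx l (a ^+ P) (b ^+ P) (c ^+ P) (d ^+ P) ->
  (y1 \in y ^: Y)%g || (y2 \in y ^: Y)%g.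
Proof.
move=> det1 Dy Dy1 Dy2.
have four_neq0 : (4 : Fq) != 0.
  by rewrite (_ : 4 = 2 * 2); [rewrite mulf_neq0 | ring].
have [tr4 | tr4] := eqVneq ((a + d) ^+ 2) 4; last first.
  apply/orP; left.
  (* Completing the square in the determinant s^2 + s t (a + d) + t^2 of s + t y gives this form,
     with r = s + (a + d) t / 2. *)
  have [|r [t Dgam]] := @sum_squares Fq oddFq (1 - (a + d) ^+ 2 / 4) gam.
    rewrite subr_eq0; apply: contraNneq tr4 => D1.
    by rewrite -(divfK four_neq0 ((a + d) ^+ 2)) -D1 mul1r.
  pose s := r - (a + d) * t / 2.
  have Dg : s ^+ 2 + s * t * (a + d) + t ^+ 2 = gam.
    by rewrite -Dgam /s; field; rewrite four_neq0 two_neq0.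
  have Dg' : (s + t * a) * (s + t * d) - t ^+ 2 * (b * c) = gam.
    by rewrite -Dg -[in RHS](mulr1 (t ^+ 2)) -det1; ring.
  (* This is (s + t y) diag(gam^-1, 1), of determinant 1, whose first factor commutes with y. *)
  apply: (@sl2_conj _ _ ((s + t * a) / gam) (t * b) (t * c / gam) (s + t * d)).
    by apply: (mulIf gam_neq0); rewrite mul1r -[RHS]Dg'; field.
  rewrite Dy Dy1 !sl2mxM; congr sl2mx; field; exact: gam_neq0.
apply/orP; right.
have trP : (a + d) ^+ P = a + d.
  have: (a + d - 2) * (a + d + 2) = 0.
    by rewrite (_ : _ * _ = (a + d) ^+ 2 - 4); [rewrite tr4 subrr | ring].
  have two_P : (2 : Fq) ^+ P = 2 by rewrite -[2]/(1 + 1) frobD !expr1n.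
  move/eqP; rewrite mulf_eq0 subr_eq0 addr_eq0 => /orP[] /eqP->.
    exact: two_P.
  by rewrite exprNn two_P -signr_odd oddP expr1 mulN1r.
have trE : a ^+ P + d ^+ P = a + d by rewrite -frobD.
have oppP (x : Fq) : (- x) ^+ P = - x ^+ P by rewrite exprNn -signr_odd oddP
  expr1 mulN1r.
have detE : a ^+ P * d ^+ P - b ^+ P * c ^+ P = 1.
  by rewrite -!exprMn -oppP -frobD det1 expr1n.
(* As [P] is odd, raising to the power [P] preserves square classes. *)
have sqP (x : Fq) : x ^+ P = x * (x ^+ P./2) ^+ 2.
  by rewrite -exprM muln2 -exprS -[in LHS](odd_double_half P) oddP.
have [c0 | nz_c] := eqVneq c 0; last first.
  set u := c ^+ P./2; have nz_u : u != 0 by rewrite expf_neq0.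
  apply: (@sl2_conj _ _ u ((a - a ^+ P) / (c * u)) 0 u^-1).
    by rewrite mulr0 subr0 divff.
  by rewrite Dy Dy2 [c ^+ P]sqP; apply: sl2_lower; rewrite -?sqP.
have [b0 | nz_b] := eqVneq b 0; last first.
  set u := b ^+ P./2; have nz_u : u != 0 by rewrite expf_neq0.
  apply: (@sl2_conj _ _ u^-1 0 ((d - d ^+ P) / (b * u)) u).
    by rewrite mul0r subr0 mulVf.
  by rewrite Dy Dy2 [b ^+ P]sqP; apply: sl2_upper; rewrite -?sqP.
have P_gt0 : (0 < P)%N by case: (P) oddP.
rewrite b0 c0 !expr0n gtn_eqF // in Dy Dy2 det1 detE *.
(* For a diagonal y, (a - d)^2 = (a + d)^2 - 4 = 0, so y is scalar and fixed by the power map. *)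
have ad : a = d.
  apply/eqP; rewrite -subr_eq0 -sqrf_eq0
    (_ : _ ^+ 2 = (a + d) ^+ 2 - 4 * (a * d - 0 * 0)).
    by rewrite det1 tr4 mulr1 subrr.
  by ring.
have aP : a ^+ P = a.
  by move: trE; rewrite -ad => trE2; apply: (mulfI two_neq0);
    rewrite !mulr_natl !mulr2n.
rewrite (_ : y2 = y) ?class_refl //; apply: GLval_inj.
by rewrite Dy Dy2 -ad aP.
Qed.

End SL2Classes.

(** * The diagonal automorphism, field automorphisms and the torus *)

Section Automorphisms.
Variables (l : nat) (Fq : finFieldType) (K : closedFieldType).
Variable iota : {rmorphism Fq -> K}.
Local Notation n := (l.+1 + l.+1)%N.
Local Notation GLq := {'GL_n[Fq]}.
Local Notation partN := (@partN l Fq K iota).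
Implicit Types (R : {set 'I_l.+1}) (g x y : GLq).

Lemma dgmx_unit (v : 'I_n -> Fq) : (forall k, v k != 0) -> dgmx v \in unitmx.
Proof.
move=> nz_v; case: (@mulmx1_unit _ _ (dgmx v) (dgmx (fun k => (v k)^-1))) => //.
rewrite dgmxM; apply/matrixP=> a b; rewrite dgmxE mxE.
by case: eqP => [-> | _]; rewrite ?divff.
Qed.

Lemma mono_nz (F : fieldType) (x y : 'M[F]_n) :
  (forall a b, (x a b == 0) = (y a b == 0)) -> mono x = mono y.
Proof.
move=> xy; apply: eq_forallb => k; congr (_ ==> _); apply: eq_existsb => a.
by congr (_ && _); apply: eq_forallb => b; rewrite xy.
Qed.

Section Diagonal.
Variables (gam : Fq) (gam_neq0 : gam != 0).

Definition simv (k : 'I_n) : Fq := if side k then 1 else gam.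
Definition simd : GLq := toGL (dgmx simv).
Definition simJ (g : GLq) : GLq := (simd * g * simd^-1)%g.

Lemma simv_neq0 k : simv k != 0.
Proof. by rewrite /simv; case: side; rewrite ?oner_eq0. Qed.

Lemma simv_bar k : simv k * simv (bar k) = gam.
Proof. by rewrite /simv side_bar; case: side; rewrite ?mulr1 ?mul1r. Qed.

Lemma GLval_simd : GLval simd = dgmx simv.
Proof. by rewrite toGLK // dgmx_unit // => k; apply: simv_neq0. Qed.

Lemma simJE g a b : GLval (simJ g) a b = simv a * GLval g a b / simv b.
Proof.
apply: (canRL (mulfK (simv_neq0 b))).
have : (simJ g * simd)%g = (simd * g)%g by rewrite mulgKV.
move/(congr1 (@GLval n Fq)); rewrite !GL_MxE GLval_simd => /matrixP/(_ a b).
by rewrite mul_mx_dgmx mul_dgmx.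
Qed.

Lemma Sp_simJ g : Sp (GLval g) -> Sp (GLval (simJ g)).
Proof.
move/SpP=> Sg; apply/SpP=> k k'.
transitivity (gam / (simv k * simv k') * ((-1) ^+ side k *+ (k' == bar k))).
  rewrite -Sg big_distrr /=; apply: eq_bigr => a _;
    rewrite !simJE -(simv_bar a).
  by field; rewrite !simv_neq0.
case: (eqVneq k' (bar k)) => [-> | _]; last by rewrite !mulr0n mulr0.
by rewrite simv_bar divff ?mul1r.
Qed.

Lemma partN_simJ R g : g \in partN R -> simJ g \in partN R.
Proof.
rewrite !in_partN => /andP[/memNP[Sg Mg] /suppP Rg].
apply/andP; split; last first.
  apply/suppP=> k k' /Rg; rewrite simJE => ->.
  by case: (eqVneq k k') => [-> | _];
    rewrite ?mulr1 ?divff ?simv_neq0 ?mulr0 ?mul0r.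
apply/memNP; split; first exact: Sp_simJ.
rewrite (@mono_nz _ _ (GLval g)) // => a b.
by rewrite simJE !mulf_eq0 invr_eq0 !(negPf (simv_neq0 _)) orbF.
Qed.

Lemma simJM : {morph simJ : x y / (x * y)%g}.
Proof. by move=> x y; rewrite /simJ !mulgA mulgKV. Qed.

Lemma simJ_inj : injective simJ.
Proof. by move=> x y /mulIg/mulgI. Qed.

Lemma simJ_auto R : is_auto (partN_group iota R) simJ.
Proof.
by split=> [g | x y _ _ | x y _ _];
  [apply: partN_simJ | apply: simJ_inj | rewrite simJM].
Qed.

End Diagonal.

Section Power.
(** In the application, [sigma] is a power of [F0] and [P] the corresponding power of p. *)
Variables (P : nat) (sigma : GLq -> GLq).
Hypotheses (oddP : odd P) (sigma_inj : injective sigma).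
Hypothesis sigmaM : {morph sigma : x y / (x * y)%g}.
Hypothesis frobD : forall s t : Fq, (s + t) ^+ P = s ^+ P + t ^+ P.
Hypothesis sigmaE : forall g a b, GLval (sigma g) a b = GLval g a b ^+ P.

Let P_gt0 : (0 < P)%N. Proof. by case: (P) oddP. Qed.

Lemma expP_eq0 (s : Fq) : (s ^+ P == 0) = (s == 0).
Proof. by rewrite expf_eq0 P_gt0. Qed.

Lemma expP_bool (b : bool) : (b%:R : Fq) ^+ P = b%:R.
Proof. by case: b; rewrite ?expr1n // expr0n gtn_eqF. Qed.

Lemma partN_sigma R g : g \in partN R -> sigma g \in partN R.
Proof.
rewrite !in_partN => /andP[/memNP[Sg Mg] /suppP Rg].
apply/andP; split; last by apply/suppP=> k k' /Rg; rewrite sigmaE => ->;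
  apply: expP_bool.
apply/memNP; split; last first.
  by rewrite (@mono_nz _ _ (GLval g)) // => a b; rewrite sigmaE expP_eq0.
have sgP b : ((-1) ^+ b : Fq) ^+ P = (-1) ^+ b.
  by rewrite exprAC -[(-1) ^+ P]signr_odd oddP expr1.
move/SpP: Sg => Sg; apply/SpP=> k k'.
transitivity ((\sum_a (-1) ^+ side a * GLval g a k * GLval g (bar a) k') ^+ P).
  rewrite (big_morph _ frobD (_ : 0 ^+ P = 0)); last by rewrite expr0n gtn_eqF.
  by apply: eq_bigr => a _; rewrite !exprMn !sigmaE sgP.
by rewrite Sg; case: (_ == _); rewrite ?sgP // expr0n gtn_eqF.
Qed.

Lemma sigma_auto R : is_auto (partN_group iota R) sigma.
Proof.
by split=> [g | x y _ _ | x y _ _];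
  [apply: partN_sigma | apply: sigma_inj | rewrite sigmaM].
Qed.

End Power.

Section Torus.
Variables (gam : Fq) (gam_neq0 : gam != 0).

Definition torv (e : 'I_l.+1 -> nat) (k : 'I_n) : Fq :=
  if idx k == ord0 then 1
  else if side k then gam ^- e (idx k) else gam ^+ e (idx k).
Definition tor e : GLq := toGL (dgmx (torv e)).

Lemma torv_neq0 e k : torv e k != 0.
Proof.
by rewrite /torv; case: ifP => _; [rewrite oner_eq0 | case: side;
  rewrite ?invr_eq0 expf_neq0].
Qed.

Lemma GLval_tor e : GLval (tor e) = dgmx (torv e).
Proof. by rewrite toGLK // dgmx_unit // => k; apply: torv_neq0. Qed.

Lemma eq_tor e f : e =1 f -> tor e = tor f.
Proof.
by move=> ef; apply: GLval_inj; rewrite !GLval_tor; apply: eq_dgmx => k;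
  rewrite /torv ef.
Qed.

Lemma torD e f : (tor e * tor f)%g = tor (fun i => e i + f i)%N.
Proof.
apply: GLval_inj; rewrite GL_MxE !GLval_tor dgmxM; apply: eq_dgmx => k.
rewrite /torv; case: ifP => _; first by rewrite mulr1.
by case: side; rewrite exprD ?invfM.
Qed.

Lemma tor0 : tor (fun=> 0%N) = 1%g.
Proof.
apply: GLval_inj; rewrite GLval_tor; apply/matrixP=> a b; rewrite dgmxE mxE.
by rewrite /torv !expr0 invr1 !if_same.
Qed.

Lemma torX e k : (tor e ^+ k)%g = tor (fun i => e i * k)%N.
Proof.
elim: k => [|k IHk]; first by rewrite expg0 -tor0; apply: eq_tor => i;
  rewrite muln0.
by rewrite expgS IHk torD; apply: eq_tor => i; rewrite mulnS.
Qed.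

Lemma tor_partN e : tor e \in partN (~: [set ord0]).
Proof.
rewrite in_partN; apply/andP; split; last first.
  apply/suppP=> k k' nk; rewrite GLval_tor dgmxE;
    case: (eqVneq k k') nk => // <-.
  by rewrite /torv !inE andbb negbK => ->.
apply/memNP; rewrite GLval_tor; split.
  apply/Sp_dgmx=> k; rewrite /torv idx_bar side_bar; case: ifP => _;
    first by rewrite mulr1.
  by case: side; rewrite /= ?mulVf ?divff ?expf_neq0.
apply/forall_inP=> k k0; apply/exists_inP; exists k => //; apply/forall_inP=> b.
by rewrite dgmxE; case: (eqVneq b k) => //; rewrite eqxx.
Qed.

(* The plane <e_0, f_0> is fixed pointwise: [torv] is 1 there, and
   [cotor ord0] is 1. *)
Definition cotor (i : 'I_l.+1) : GLq := tor (fun j => i == j).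

Lemma prod_cotor (e : 'I_l.+1 -> nat) : (\prod_j cotor j ^+ e j)%g = tor e.
Proof.
have prodE (s : seq 'I_l.+1) : (\prod_(j <- s) cotor j ^+ e j)%g =
    tor (fun i => \sum_(j <- s) (j == i) * e j)%N.
  elim: s => [|j s IHs].
    by rewrite big_nil -tor0; apply: eq_tor => i; rewrite big_nil.
  rewrite big_cons IHs torX torD; apply: eq_tor => i; rewrite big_cons //.
rewrite prodE; apply: eq_tor => i.
by rewrite (bigD1 i) //= eqxx mul1n big1 ?addn0 // => j /negPf->.
Qed.

End Torus.

End Automorphisms.

(** * Characters of the monomial part *)

Section MonomialPart.
Variables (l : nat) (Fq : finFieldType) (K : closedFieldType).
Variable iota : {rmorphism Fq -> K}.
Local Notation n := (l.+1 + l.+1)%N.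
Local Notation GLq := {'GL_n[Fq]}.
Local Notation partN := (@partN l Fq K iota).
Local Notation partG := (@partN_group l Fq K iota).
Local Notation N := (Nq_group l iota).
Implicit Types (R : {set 'I_l.+1}) (g x y : GLq).

Variables (gam : Fq) (gam_neq0 : gam != 0).
Hypothesis gamP : forall t : Fq, t != 0 -> exists k, t = gam ^+ k.
Variables (P P' : nat) (sigma : GLq -> GLq).
Hypotheses (oddP : odd P) (oddP' : odd P') (gamPP' : gam ^+ (P * P') = gam).
Hypotheses (sigma_inj : injective sigma)
  (sigmaM : {morph sigma : x y / (x * y)%g}).
Hypothesis frobD : forall s t : Fq, (s + t) ^+ P = s ^+ P + t ^+ P.
Hypothesis sigmaE : forall g a b, GLval (sigma g) a b = GLval g a b ^+ P.

Local Notation o := #|Fq|.-1.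
Local Notation tau g := (tau (GLval g)).
Local Notation cotor := (cotor gam).
Local Notation simJ := (simJ gam).
Local Notation H := (partG (~: [set ord0])).

(** Together with [psg], this is the signed permutation of the coordinates: [psg g i] tells whether
    the line of e_i goes to the line of some f_j. *)
Definition pidx (g : GLq) (i : 'I_l.+1) := idx (tau g (vidx i false)).
Definition psg (g : GLq) (i : 'I_l.+1) := side (tau g (vidx i false)).

Let one_neq0 : (1 : Fq) != 0 := oner_neq0 Fq.

Lemma N_sim g : g \in N ->
  (GLval g)^T *m symp_form Fq l *m GLval g = 1 *: symp_form Fq l.
Proof. by case/memNP=> Sg _; rewrite scale1r. Qed.

Lemma N_mono g : g \in N -> mono (GLval g).
Proof. by case/memNP. Qed.

Lemma N_tau_bar g k : g \in N -> tau g (bar k) = bar (tau g k).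
Proof. by move=> Ng; apply: (tau_bar one_neq0 (N_sim Ng) (N_mono Ng)). Qed.

Lemma N_tau_inj g : g \in N -> injective (tau g).
Proof. by move=> Ng; apply: (tau_inj one_neq0 (N_sim Ng) (N_mono Ng)). Qed.

Lemma N_tau_outer g k : g \in N -> (idx (tau g k) != ord0) = (idx k != ord0).
Proof. by move=> Ng; apply: (tau_outer one_neq0 (N_sim Ng) (N_mono Ng)). Qed.

Lemma N_tau_inner g k : g \in N -> (idx (tau g k) == ord0) = (idx k == ord0).
Proof. by move=> Ng; apply: negb_inj; apply: N_tau_outer. Qed.

Lemma N_tau_supp g k : g \in N -> idx k != ord0 ->
  [/\ GLval g (tau g k) k != 0, idx (tau g k) != ord0
    & forall a, GLval g a k != 0 -> a = tau g k].
Proof. by move=> Ng; apply: (tau_supp one_neq0 (N_sim Ng) (N_mono Ng)). Qed.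

Lemma N_supp g a k : g \in N -> GLval g a k != 0 ->
  a = tau g k \/ idx a = ord0 /\ idx k = ord0.
Proof. by move=> Ng; apply: (mono_supp one_neq0 (N_sim Ng) (N_mono Ng)). Qed.

Lemma idx_tau g k : g \in N -> idx (tau g k) = pidx g (idx k).
Proof.
move=> Ng; rewrite /pidx; case: (eq_idx (idx_vidx (idx k) false)) => Dk.
  by rewrite -Dk.
by rewrite {1}Dk N_tau_bar // idx_bar.
Qed.

Lemma side_tau g k : g \in N -> side (tau g k) = side k (+) psg g (idx k).
Proof.
move=> Ng; rewrite /psg -{1 2}(vidxK k); case: (side k); rewrite side_vidx //.
rewrite (_ : vidx _ true = bar (vidx (idx k) false)) ?N_tau_bar ?side_bar //.
by rewrite /bar idx_vidx side_vidx.
Qed.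

Lemma pidx_inj g : g \in N -> injective (pidx g).
Proof.
move=> Ng i j eq_ij; have := eq_idx eq_ij; rewrite -!N_tau_bar //.
case=> /(N_tau_inj Ng)/(congr1 (@idx l)); rewrite ?idx_bar !idx_vidx //.
Qed.

Lemma expo : gam ^+ o = 1.
Proof. by apply: (mulfI gam_neq0); rewrite -exprS prednK ?expf_card ?mulr1 //
  (cardD1 0). Qed.

Lemma exp_o1 : gam ^+ o.-1 = gam^-1.
Proof.
apply: (mulfI gam_neq0); rewrite -exprS divff // prednK ?expo //.
by rewrite -ltnS prednK ?finNzRing_gt1 //; apply: leq_trans (finNzRing_gt1 Fq).
Qed.

Lemma tor_conj g (e f : 'I_l.+1 -> nat) : g \in N ->
    (forall k, idx k != ord0 -> torv gam f (tau g k) = torv gam e k) ->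
  (g * tor gam e = tor gam f * g)%g.
Proof.
move=> Ng ef; apply: GLval_inj; rewrite !GL_MxE !GLval_tor //.
apply/matrixP=> a k; rewrite mul_mx_dgmx mul_dgmx mulrC.
have [-> | nz_g] := eqVneq (GLval g a k) 0; first by rewrite !mulr0.
have [k0 | k0] := eqVneq (idx k) ord0.
  have := N_inner Ng nz_g; rewrite !inE k0 eqxx => /eqP a0.
  by rewrite /torv k0 a0.
have [_ _ tauP] := N_tau_supp Ng k0.
by rewrite (tauP a nz_g) ef.
Qed.

Lemma cotor_conj g j : g \in N ->
  (g * cotor j = cotor (pidx g j) ^+ (if psg g j then o.-1 else 1%N) * g)%g.
Proof.
move=> Ng; rewrite torX //; apply: tor_conj => // k k0.
rewrite /torv N_tau_inner // (negPf k0).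
rewrite idx_tau // (inj_eq (pidx_inj Ng)) side_tau //.
case: eqP => [<- | _]; last by rewrite mul0n !expr0 invr1 !if_same.
by case: (psg g j); case: (side k); rewrite /= mul1n ?exp_o1 ?expr1 ?invrK.
Qed.

Lemma H_sub_N g : g \in H -> g \in N.
Proof. by apply/subsetP/partN_sub. Qed.

Lemma H_outer g a k : g \in H -> GLval g a k != 0 ->
  a = tau g k \/ a = k /\ idx k = ord0.
Proof.
move=> Hg nz_g; have [|[a0 k0]] := N_supp (H_sub_N Hg) nz_g; first by left.
right; split=> //; move: Hg; rewrite in_partN => /andP[_ /suppP/(_ a k)].
rewrite !inE a0 k0 eqxx => /(_ isT) Dg; rewrite Dg in nz_g.
by apply/eqP; apply: contraNT nz_g => /negPf->.
Qed.

Lemma mul_torE g e a k : GLval (g * tor gam e)%g a k = GLval g a k * torv gam e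
  k.
Proof. by rewrite GL_MxE GLval_tor // mul_mx_dgmx. Qed.

(** Conjugation scales the entry at [(a, k)] by [simv a / simv k], which for a nonzero entry differs
    from 1 only if [g] exchanges the sides, and then is gam^-1 or gam according to the side of
    [k]. *)
Lemma simJ_tor g : g \in H ->
  simJ g = (g * \prod_j cotor j ^+ (if psg g j then o.-1 else 0%N))%g.
Proof.
move=> Hg; have Ng := H_sub_N Hg; rewrite prod_cotor //; apply: GLval_inj.
apply/matrixP=> a k; rewrite simJE // mul_torE mulrC mulrA [_^-1 * _]mulrC.
have [-> | nz_g] := eqVneq (GLval g a k) 0; first by rewrite mulr0 mul0r.
rewrite mulrC; congr (_ * _).
have [k0 | k0] := eqVneq (idx k) ord0.
  case: (H_outer Hg nz_g) => [-> | [-> _]]; rewrite ?tau_inner // /torv k0 eqxx.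
    by rewrite divff ?simv_neq0.
  by rewrite divff ?simv_neq0.
have [_ _ tauP] := N_tau_supp Ng k0; rewrite (tauP a nz_g).
rewrite /torv (negPf k0) /simv side_tau //.
case: (psg g (idx k)); case: (side k);
  rewrite /= ?exp_o1 ?expr0 ?invrK ?invr1 ?divr1 ?mul1r ?mulr1 ?divff ?oner_eq0
    //.
Qed.

Lemma simJ_cotor (j : 'I_l.+1) : simJ (cotor j) = cotor j.
Proof.
apply: GLval_inj; apply/matrixP=> a k; rewrite simJE // GLval_tor // dgmxE.
by case: eqP => [-> | _]; rewrite ?mulr0n ?mulr0 ?mul0r // mulrAC divff ?mul1r
  ?simv_neq0.
Qed.

Lemma sigma_cotor (j : 'I_l.+1) : sigma (cotor j) = (cotor j ^+ P)%g.
Proof.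
apply: GLval_inj; apply/matrixP=> a k;
  rewrite sigmaE torX // !GLval_tor // !dgmxE.
have P_gt0 : (0 < P)%N by case: (P) oddP.
case: eqP => _; last by rewrite !mulr0n expr0n gtn_eqF.
rewrite !mulr1n /torv; case: ifP => _; first by rewrite expr1n.
by case: (side a); rewrite ?exprVn -exprM.
Qed.

Lemma cotorPP' (j : 'I_l.+1) : (cotor j ^+ (P * P') = cotor j)%g.
Proof.
apply: GLval_inj; rewrite torX // !GLval_tor //; apply: eq_dgmx => k.
rewrite /torv; case: ifP => // _; case: (j == idx k); rewrite ?mul0n // mul1n.
by rewrite gamPP' expr1.
Qed.

Lemma cotorX_o (j : 'I_l.+1) : (cotor j ^+ o = 1)%g.
Proof.
rewrite torX // -(tor0 l gam_neq0); apply: GLval_inj; rewrite !GLval_tor //.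
apply: eq_dgmx => k; rewrite /torv; case: ifP => // _.
by case: (j == idx k); rewrite ?mul0n // mul1n expo expr0.
Qed.

(** The index [ord0] may lie in [R] or in its complement, but [H] acts trivially on that plane. *)
Definition mpart R : {set GLq} := partN (R :\ ord0).

Lemma mpart_sub R : {subset mpart R <= H}.
Proof. by apply/subsetP/partNS; rewrite setDE subsetIr. Qed.

Lemma mpart_cent R : {in mpart R & mpart (~: R), forall x y, commute x y}.
Proof.
move=> x y Rx Ry; apply: (partN_comm Rx); apply: subsetP Ry.
by apply: partNS; apply/subsetP=> i; rewrite !inE => /andP[-> ->].
Qed.

Lemma tau_supp_id R g k : g \in partN R -> idx k \notin R -> tau g k = k.
Proof.
rewrite in_partN => /andP[Ng /suppP Rg] nRk.
have [k0 | k0] := eqVneq (idx k) ord0; first exact: tau_inner.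
have [nz_g _ _] := N_tau_supp Ng k0; apply/eqP.
by apply: contraNT nz_g => /negPf; rewrite Rg ?(negPf nRk) ?andbF // => ->.
Qed.

Lemma mpart_stable R : {in mpart R, forall x, pidx x @: R = R}.
Proof.
move=> x Rx; have Nx := H_sub_N (mpart_sub Rx).
apply/eqP; rewrite eqEcard card_imset ?leqnn ?andbT; last exact: pidx_inj.
have fix_nR i : i \notin R -> pidx x i = i.
  move=> nRi; rewrite /pidx (tau_supp_id Rx) ?idx_vidx //.
  by rewrite !inE (negPf nRi) andbF.
apply/subsetP=> _ /imsetP[j Rj ->]; apply: contraT => nR.
by have /(pidx_inj Nx) Dj := fix_nR _ nR; rewrite Dj Rj in nR.
Qed.

Lemma mpart_split R : {in H, forall x, pidx x @: R = R ->
  exists x1 x2, [/\ x1 \in mpart R, x2 \in mpart (~: R), x = (x1 * x2)%g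
                 & {in R, psg x =1 psg x1}]}.
Proof.
move=> x Hx piR; have Nx := H_sub_N Hx.
have piRE i : (pidx x i \in R) = (i \in R).
  by rewrite -{1}piR mem_imset //; apply: pidx_inj.
have xR : preserves (R :\ ord0) (GLval x).
  move=> a k nz_x; rewrite !inE; case: (H_outer Hx nz_x) => [-> | [-> //]].
  by rewrite N_tau_outer // idx_tau // piRE.
have [R1 R2 Dx] := partN_split Nx xR.
set x1 := toGL _ in R1 Dx *; set x2 := toGL _ in R2 Dx *.
exists x1, x2; split=> //.
  rewrite /mpart in_partN; have := R2; rewrite in_partN => /andP[-> R2x] /=.
  have sx : supp (~: [set ord0]) (GLval x) by move: Hx;
    rewrite in_partN => /andP[].
  have Dx2 : GLval x2 = res (~: (R :\ ord0)) (GLval x).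
    rewrite /x2 toGLK //; have [_ SU _ _] := @Sp_subgroup Fq l; apply: SU.
    apply: res_Sp; first by case/memNP: Nx.
    by move=> a k /xR; rewrite !in_setC => ->.
  have s2 : supp (~: [set ord0]) (GLval x2).
    apply/suppP=> k k' nk; rewrite Dx2 mxE; case: ifP => // _.
    by apply: (suppP _ _ sx).
  apply: suppS (suppI R2x s2); apply/subsetP=> i.
  rewrite in_setI !in_setC !in_setD1 in_set1 in_setC.
  by case: (i == ord0); case: (i \in R).
move=> j Rj; have N1 := H_sub_N (mpart_sub R1).
rewrite /psg; congr side.
have [-> | j0] := eqVneq j ord0; first by rewrite !tau_inner ?idx_vidx.
have k0 : idx (vidx j false) != ord0 by rewrite idx_vidx.
have [nz_x _ _] := N_tau_supp Nx k0; have [_ _ tauP] := N_tau_supp N1 k0.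
apply: tauP; rewrite /x1 toGLK; last first.
  have [_ SU _ _] := @Sp_subgroup Fq l; apply: SU.
  by apply: res_Sp => //; case/memNP: Nx.
rewrite mxE ifT // !in_setD1 N_tau_outer // k0 idx_tau // piRE.
by rewrite idx_vidx Rj.
Qed.

Lemma expP1 : exists h, forall t : Fq, t ^+ P = t * t ^+ h.*2.
Proof. by exists P./2 => t; rewrite -exprS -[in LHS](odd_double_half P) oddP.
Qed.

(** The nonzero entry in the column of e_j is a power of [gam], and its [P]-th power is itself times
    an even power of it. *)
Lemma mpart_sigma R : {in mpart R, forall x, exists2 m : 'I_l.+1 -> nat,
  {in ~: R, forall j, m j = 0%N} &
  sigma x = (x * \prod_j cotor j ^+ (m j).*2)%g}.
Proof.
move=> x Rx; have Hx := mpart_sub Rx; have Nx := H_sub_N Hx.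
have [h hP] := expP1.
pose al j := GLval x (tau x (vidx j false)) (vidx j false).
have al_exp j : exists u, (j != ord0) ==> (al j == gam ^+ u).
  have [-> | j0] := eqVneq j ord0; first by exists 0%N.
  have [|nz_al _ _] := @N_tau_supp x (vidx j false) Nx;
    first by rewrite idx_vidx.
  by have [u Du] := gamP nz_al; exists u; rewrite /= /al Du.
pose u j := xchoose (al_exp j).
have uP j : j != ord0 -> al j = gam ^+ u j.
  by move=> j0; have /implyP/(_ j0)/eqP := xchooseP (al_exp j).
pose m j := if (j != ord0) && (j \in R) then (u j * h)%N else 0%N.
exists m => [j|]; first by rewrite in_setC /m => /negPf->; rewrite andbF.
rewrite prod_cotor //; apply: GLval_inj; apply/matrixP=> a k.
rewrite mul_torE sigmaE /torv.
have [kR | kR] := boolP (idx k \in R :\ ord0); last first.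
  have -> : m (idx k) = 0%N by rewrite /m -in_setD1 (negPf kR).
  rewrite double0 !expr0 invr1 !if_same mulr1.
  move: Rx; rewrite in_partN => /andP[_ /suppP->];
    last by rewrite (negPf kR) andbF.
  exact: expP_bool.
have [nz_x | nz_x] := eqVneq (GLval x a k) 0.
  have P_gt0 : (0 < P)%N by case: (P) oddP.
  by rewrite nz_x mul0r expr0n gtn_eqF.
have [k0 Rk] := setD1P kR.
have [_ _ tauP] := N_tau_supp Nx k0; rewrite (tauP a nz_x) hP (negPf k0).
congr (_ * _); rewrite /m -in_setD1 kR.
case Dk: (side k).
  set b := GLval x _ _; pose b' := al (idx k).
  have Dk' : bar k = vidx (idx k) false by rewrite /bar Dk.
  (* The entries in the columns [k] and [bar k] are inverse to each other up to a sign, which the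
     even exponent removes. *)
  have bb : (b * b') ^+ 2 = 1.
    have := tau_pair one_neq0 (N_sim Nx) (N_mono Nx) (bar k) k0.
    rewrite -N_tau_bar // eqxx mul1r Dk' -/b -[GLval x _ _]/b'.
    move/(congr1 (fun t => t ^+ 2)).
    by rewrite -mulrA exprMn !sqrr_sign mul1r.
  have nz_b' : b' != 0.
    by apply: contra_eq_neq bb => ->; rewrite mulr0 expr0n eq_sym oner_eq0.
  apply: (mulIf (expf_neq0 h.*2 nz_b')); rewrite -exprMn -[h.*2]mul2n exprM bb.
  rewrite expr1n /b' uP // -exprM -mul2n mulnCA mulVf //.
  by rewrite expf_neq0.
have -> : GLval x (tau x k) k = al (idx k) by rewrite /al -Dk vidxK.
by rewrite uP // -exprM -doubleMr.
Qed.

Lemma monomial_part_fixed (eta : 'CF(H)) : eta \in irr H ->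
    {in H, forall x, eta (simJ x) = eta (sigma x)} ->
  {in H, forall x, eta (simJ x) = eta x}.
Proof.
have o_gt0 : (0 < o)%N by rewrite -ltnS prednK ?finNzRing_gt1 // (cardD1 0).
apply: (@monomial_twist_fixed _ H _ cotor o _ _ o_gt0 _ pidx psg _ _ simJ sigma
  P P'
   _ _ _ _ _ _ _ _ mpart).
- by move=> j; apply: tor_partN.
- by move=> i j; rewrite /commute !torD //; apply: eq_tor => // k;
    rewrite addnC.
- exact: cotorX_o.
- by move=> x /H_sub_N; apply: pidx_inj.
- by move=> x /H_sub_N Nx j; apply: cotor_conj.
- exact: simJ_auto.
- exact: (sigma_auto iota oddP sigma_inj sigmaM frobD sigmaE). 
- exact: simJ_cotor.
- exact: simJ_tor.
- exact: sigma_cotor.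
- exact: oddP.
- exact: oddP'.
- exact: cotorPP'.
- exact: mpart_sub.
- exact: mpart_cent.
- exact: mpart_stable.
- exact: mpart_split.
exact: mpart_sigma.
Qed.

End MonomialPart.

(** * Characters of N *)

Section FixedCharacters.
Variables (l : nat) (Fq : finFieldType) (K : closedFieldType).
Variable iota : {rmorphism Fq -> K}.
Local Notation n := (l.+1 + l.+1)%N.
Local Notation GLq := {'GL_n[Fq]}.
Local Notation J := (symp_form Fq l).
Local Notation partG := (@partN_group l Fq K iota).
Local Notation N := (Nq_group l iota).
Local Notation Y := (partG [set ord0]).
Local Notation H := (partG (~: [set ord0])).
Implicit Types g x y : GLq.

Section Twists.
Variables (gam : Fq) (gam_neq0 : gam != 0).
Hypothesis gamP : forall t : Fq, t != 0 -> exists k, t = gam ^+ k.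
Hypotheses (oddFq : odd #|Fq|) (two_neq0 : (2 : Fq) != 0).
Variables (P P' : nat) (sigma : GLq -> GLq).
Hypotheses (oddP : odd P) (oddP' : odd P') (gamPP' : gam ^+ (P * P') = gam).
Hypotheses (sigma_inj : injective sigma)
  (sigmaM : {morph sigma : x y / (x * y)%g}).
Hypothesis frobD : forall s t : Fq, (s + t) ^+ P = s ^+ P + t ^+ P.
Hypothesis sigmaE : forall g a b, GLval (sigma g) a b = GLval g a b ^+ P.
Local Notation simJ := (simJ gam).

Lemma sl2_fixed (chi : 'CF(Y)) : chi \in irr Y ->
    {in Y, forall x, chi (simJ x) = chi (sigma x)} ->
  {in Y, forall x, chi (simJ x) = chi x}.
Proof.
apply: eq_twist_fixed => [||y Yy]; first exact: simJ_auto.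
  exact: (sigma_auto iota oddP sigma_inj sigmaM frobD sigmaE).
have [a [b [c [d [Dy det1]]]]] := sl2P Yy.
apply: (sl2_class iota oddFq two_neq0 gam_neq0 oddP frobD det1 Dy).
  apply/matrixP=> k k'; rewrite simJE // Dy !mxE /simv.
  case: ((idx k == ord0) && (idx k' == ord0)).
    case: (side k); case: (side k'); rewrite ?mul1r ?divr1 //;
      first exact: mulrC.
    by rewrite mulrAC divff ?mul1r.
  case: (eqVneq k k') => [-> | _]; last by rewrite mulr0 mul0r.
  by rewrite mulr1; case: (side k'); rewrite ?divff ?oner_eq0.
apply/matrixP=> k k'; rewrite sigmaE Dy !mxE.
case: ((idx k == ord0) && (idx k' == ord0)); last by rewrite expP_bool.
by case: (side k); case: (side k').
Qed.

(** Along N = Y x H, [psi] is a product of two irreducible characters. Setting one variable to 1 and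
    cancelling the nonzero degree gives the hypothesis for each factor. *)
Lemma N_twist_fixed (psi : 'CF(N)) : psi \in irr N ->
    {in N, forall x, psi (simJ x) = psi (sigma x)} ->
  {in N, forall x, psi (simJ x) = psi x}.
Proof.
case/irrP=> i ->; have KxH : (Y \x H)%g = N := partN_dprod l iota.
rewrite -(inv_dprod_IirrK KxH i); case: (inv_dprod_Iirr KxH i) => i1 i2.
rewrite dprod_IirrE => eq_ds.
have [_ defN _ _] := dprodP KxH.
have YN y h : y \in Y -> h \in H -> (y * h)%g \in N by rewrite -defN;
  apply: mem_mulg.
have sigmaY R x : x \in partG R -> sigma x \in partG R.
  exact: (partN_sigma oddP frobD sigmaE).
have eq_ds' y h : y \in Y -> h \in H ->
    'chi_i1 (simJ y) * 'chi_i2 (simJ h) = 'chi_i1 (sigma y) * 'chi_i2 (sigma h).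
  move=> Yy Hh; have := eq_ds _ (YN _ _ Yy Hh).
  by rewrite simJM sigmaM !cfDprodE ?sigmaY //; apply: partN_simJ.
have simJ1 : simJ (1%g : GLq) = 1%g by apply: (mulgI (simJ 1%g));
  rewrite -simJM !mulg1.
have sigma1 : sigma 1%g = 1%g by apply: (mulgI (sigma 1%g));
  rewrite -sigmaM !mulg1.
have eq1 : {in Y, forall y, 'chi_i1 (simJ y) = 'chi_i1 y}.
  apply: sl2_fixed (mem_irr _) _ => y Yy; apply: (mulIf (irr1_neq0 i2)).
  by have := eq_ds' y 1%g Yy (group1 H); rewrite simJ1 sigma1.
have eq2 : {in H, forall h, 'chi_i2 (simJ h) = 'chi_i2 h}.
  apply: (monomial_part_fixed gam_neq0 gamP oddP oddP' gamPP' sigma_inj sigmaM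
    frobD sigmaE).
    exact: mem_irr.
  move=> h Hh; apply: (mulfI (irr1_neq0 i1)).
  by have := eq_ds' 1%g h (group1 Y) Hh; rewrite simJ1 sigma1.
move=> x Nx; have := Nx; rewrite -{1}defN => /mulsgP[y h Yy Hh Dx]; rewrite Dx.
have Yy' : simJ y \in Y by apply: partN_simJ.
have Hh' : simJ h \in H by apply: partN_simJ.
by rewrite simJM !cfDprodE // eq1 // eq2.
Qed.

End Twists.

(** Division by the scalar [b] makes [g] symplectic and does not change conjugation by it. *)
Lemma sim_scalar (b : Fq) g : b != 0 -> mono (GLval g) ->
    (GLval g)^T *m J *m GLval g = b ^+ 2 *: J ->
  exists2 g', g' \in N & forall x, (g * x * g^-1 = g' * x * g'^-1)%g.
Proof.
move=> nz_b Mg Sg; have ug : b^-1 *: GLval g \in unitmx.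
  by rewrite unitmxZ ?unitfE ?invr_eq0 // GL_unit.
exists (toGL (b^-1 *: GLval g)); last first.
  move=> x; apply: (mulIg (toGL (b^-1 *: GLval g))); rewrite mulgKV.
  apply: GLval_inj; rewrite !GL_MxE GL_VxE toGLK // -scalemxAr -scalemxAl.
  by rewrite mulmxKV // GL_unit.
apply/memNP; rewrite toGLK //; split; last first.
  rewrite (@mono_nz _ _ _ (GLval g)) // => a k.
  by rewrite mxE mulf_eq0 invr_eq0 (negPf nz_b).
rewrite /Sp /= [(_ *: _)^T]linearZ /= -!scalemxAl -scalemxAr Sg !scalerA.
by rewrite expr2 mulrA -(mulrA b^-1) mulVf // mulr1 mulVf ?scale1r.
Qed.

Lemma field_generator : exists2 gam : Fq, gam != 0 &
  forall t : Fq, t != 0 -> exists k, t = gam ^+ k.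
Proof.
have /cyclicP[u Du] := field_unit_group_cyclic [set: {unit Fq}]%G.
exists (FinRing.uval u); first by rewrite -unitfE; apply: valP.
move=> t nz_t; have ut : t \is a GRing.unit by rewrite unitfE.
have : FinRing.unit Fq ut \in <[u]>%g by rewrite -Du inE.
by case/cycleP=> k Dt; exists k; rewrite -FinRing.val_unitX -Dt.
Qed.

(** If the multiplier of [g] is a square, [sim_scalar] applies to [g]; otherwise q is odd and it
    applies to the quotient of [g] by [simd]. *)
Lemma tNq_decomp (gam : Fq) g : gam != 0 ->
    (forall t : Fq, t != 0 -> exists k, t = gam ^+ k) -> g \in tNq_group l iota
      ->
  exists2 g', g' \in N & (forall x, (g * x * g^-1 = g' * x * g'^-1)%g) \/
    odd #|Fq| /\ (forall x, (g * x * g^-1 = g' * simJ gam x * g'^-1)%g).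
Proof.
move=> nz_gam gamP; rewrite [_ \in _]mem_tNq mem_tGq.
case/andP=> /existsP[c /andP[nz_c /eqP Sg]] Mg.
have square b : b != 0 -> c = b ^+ 2 -> exists2 g', g' \in N &
    (forall x, (g * x * g^-1 = g' * x * g'^-1)%g) \/
    odd #|Fq| /\ (forall x, (g * x * g^-1 = g' * simJ gam x * g'^-1)%g).
  move=> nz_b Dc; rewrite Dc in Sg.
  by have [g' Ng' eq_g] := sim_scalar nz_b Mg Sg; exists g'; last by left.
have [k Dc] := gamP c nz_c.
have [odd_k | even_k] := boolP (odd k); last first.
  apply: (square (gam ^+ k./2)); first by rewrite expf_neq0.
  by rewrite Dc -{1}(odd_double_half k) (negPf even_k) add0n -muln2 exprM.
have /orP[odd_q | even_q] := orbN (odd #|Fq|); last first.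
  have Dq : #|Fq| = #|Fq|.-1.+1 by rewrite prednK // (cardD1 0).
  have odd_q1 : odd #|Fq|.-1 by move: even_q; rewrite {1}Dq /= negbK.
  (* For q even, adding the odd number q - 1 to the odd exponent [k] makes it even without changing
     the power of [gam]. *)
  have Dk : (k + #|Fq|.-1 = ((k + #|Fq|.-1)./2).*2)%N.
    by rewrite -{1}(odd_double_half (k + _)) oddD odd_k odd_q1.
  apply: (square (gam ^+ (k + #|Fq|.-1)./2)); first by rewrite expf_neq0.
  by rewrite -exprM muln2 -Dk exprD expo // mulr1.
pose h := (g * (simd l gam)^-1)%g.
have hE a b : GLval h a b = GLval g a b / simv gam b.
  apply: (canRL (mulfK (simv_neq0 nz_gam b))).
  have : (h * simd l gam)%g = g by rewrite mulgKV.
  move/(congr1 (@GLval n Fq)); rewrite GL_MxE GLval_simd // => /matrixP/(_ a b).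
  by rewrite mul_mx_dgmx.
have Mh : mono (GLval h).
  rewrite (@mono_nz _ _ _ (GLval g)) // => a b.
  by rewrite hE mulf_eq0 invr_eq0 (negPf (simv_neq0 nz_gam b)) orbF.
have Sh : (GLval h)^T *m J *m GLval h = (gam ^+ k./2) ^+ 2 *: J.
  apply/simP=> a b.
  transitivity ((simv gam a * simv gam b)^-1 *
      \sum_a0 (-1) ^+ side a0 * GLval g a0 a * GLval g (bar a0) b).
    rewrite big_distrr /=; apply: eq_bigr => a0 _; rewrite !hE.
    by field; rewrite !simv_neq0.
  rewrite (iffLR (simP _ _) Sg); case: (eqVneq b (bar a)) => [-> | _].
    have Dk : k = (k./2).*2.+1 by rewrite -{1}(odd_double_half k) odd_k.
    by rewrite simv_bar Dc {1}Dk exprS -muln2 exprM !mulrA mulVf ?mul1r.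
  by rewrite !mulr0n !mulr0.
have [|g' Ng' eq_g] := sim_scalar _ Mh Sh; first by rewrite expf_neq0.
exists g' => //; right; split=> // x; rewrite -eq_g /h /simJ invMg invgK !mulgA.
by rewrite !mulgKV.
Qed.

End FixedCharacters.

Section Main.
Variables (p m l : nat) (p_pr : prime p).
Variables (Fq : finFieldType) (cardFq : #|Fq| = (p ^ m)%N).
Variables (K : closedFieldType) (iota : {rmorphism Fq -> K}).
Local Notation n := (l.+1 + l.+1)%N.
Local Notation GLq := {'GL_n[Fq]}.
Local Notation N := (Nq_group l iota).
Local Notation tN := (tNq_group l iota).
Local Notation F0 := (Defs.F0 l p_pr cardFq).
Local Notation partG := (@partN_group l Fq K iota).

Lemma F0X_M k : {morph (F0 ^+ k)%g : x y / (x * y)%g}.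
Proof.
move=> x y; have : (F0 ^+ k)%g \in Aut [set: GLq]%G by rewrite groupX ?F0_Aut.
by move/Aut_morphic/morphicP=> ->; rewrite ?inE.
Qed.

Lemma m_gt0 : (0 < m)%N.
Proof. by rewrite lt0n; apply: contraTneq (finNzRing_gt1 Fq) => m0;
  rewrite cardFq m0. Qed.

Lemma frobXD k (s t : Fq) : (s + t) ^+ (p ^ k) = s ^+ (p ^ k) + t ^+ (p ^ k).
Proof.
apply: exprDn_pchar; have chp := card_finPcharP cardFq p_pr.
by rewrite (eq_pnat _ (pcharf_eq chp)) pnatX pnat_id.
Qed.

Lemma N_simJ gam x : gam != 0 -> x \in N -> simJ gam x \in N.
Proof.
move=> nz_gam; have partT y : (y \in partG setT) = (y \in N).
  by rewrite [LHS]in_partN andb_idr // => _; apply/suppP=> a b; rewrite !inE.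
by rewrite -!partT; apply: partN_simJ.
Qed.

Lemma tN_norm : tN \subset 'N(N).
Proof.
apply/subsetP=> g tNg; rewrite -groupV inE; apply/subsetP=> _ /imsetP[x Nx ->].
have [gam nz_gam gamP] := field_generator Fq.
rewrite conjgE invgK mulgA.
have [g' Ng' [-> | [_ ->]]] := tNq_decomp nz_gam gamP tNg.
  by rewrite !groupM ?groupV.
by rewrite (groupM (groupM Ng' (N_simJ nz_gam Nx))) ?groupV.
Qed.

Lemma N_sub_tN : N \subset tN.
Proof.
apply/subsetP=> g; rewrite [g \in N]mem_Nq => /andP[Gg Mg].
by rewrite [g \in tN]mem_tNq Gq_sub_tGq.
Qed.

(** If [g] acts as an element of N, there is nothing to prove; otherwise q is odd, [g] acts as
    [simJ] up to N, and [N_twist_fixed] applies. *)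
Lemma tNq_fixed (psi : 'CF(N)) g k : psi \in irr N -> g \in tN ->
    {in N, forall x, psi (g * x * g^-1)%g = psi ((F0 ^+ k)%g x)} ->
  {in N, forall x, psi (g * x * g^-1)%g = psi x}.
Proof.
move=> irr_psi tNg; have [gam nz_gam gamP] := field_generator Fq.
have conjN g' x : g' \in N -> x \in N -> psi (g' * x * g'^-1)%g = psi x.
  have -> : (g' * x * g'^-1 = x ^ g'^-1)%g by rewrite conjgE invgK mulgA.
  by move=> Ng' Nx; rewrite cfunJ ?groupV.
have [g' Ng' [eq_g _ x Nx | [oddq eq_g]]] := tNq_decomp nz_gam gamP tNg.
  by rewrite eq_g conjN.
have oddp : odd p by move: oddq; rewrite cardFq oddX => /orP[/eqP m0|//];
  have := m_gt0; rewrite m0.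
move=> eq_gF x Nx; rewrite eq_g conjN ?N_simJ //.
have two_neq0 : (2 : Fq) != 0.
  have chp := card_finPcharP cardFq p_pr.
  rewrite -(dvdn_pcharf chp); apply: contraL oddp;
    rewrite dvdn_prime2 // => /eqP.
  by move=> ->.
(* The product of the two exponents is p^(m k) = q^k, and raising to this power fixes [Fq]. *)
apply: (@N_twist_fixed _ _ _ _ gam nz_gam gamP oddq two_neq0
  (p ^ k) (p ^ (m * k - k)) (F0 ^+ k)%g) => //.
- by rewrite oddX oddp orbT.
- by rewrite oddX oddp orbT.
- rewrite -expnD subnKC ?leq_pmull ?m_gt0 // expnM -cardFq.
  elim: k {eq_gF} => [|k IHk]; first by rewrite expn0 expr1.
  by rewrite expnS exprM expf_card.
- exact: perm_inj.
- exact: F0X_M.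
- exact: frobXD.
- exact: F0X.
by move=> y Ny; rewrite -eq_gF // eq_g conjN ?N_simJ.
Qed.

End Main.

Local Close Scope ring_scope.

Theorem theorem4p4 (p m l : nat) (p_pr : prime p)
    (K : closedFieldType) (j : {rmorphism 'F_p -> K}) (K_alg : integralRange j)
    (Fq : finFieldType) (cardFq : #|Fq| = (p ^ m)%N)
    (iota : {rmorphism Fq -> K}) :
  let N := emb p_pr cardFq (Nq_group l iota) in
  let tN := emb p_pr cardFq (tNq_group l iota) in
  let D := embD l p_pr cardFq in
  forall psi : 'CF(N), psi \in irr N ->
    'I_(tN * D)[psi] = 'I_tN[psi] * 'I_(N * D)[psi].
Proof.
move=> N tN D psi irr_psi.
have sNtN : N \subset tN by apply: morphimS (N_sub_tN l iota).
have nNtN : tN \subset 'N(N) by apply: morphim_norms (tN_norm l iota).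
apply/eqP; rewrite eqEsubset; apply/andP; split; last first.
  apply/subsetP=> _ /mulsgP[x y /setIP[tNx Ix] /setIP[NDy Iy] ->].
  by rewrite inE groupM // andbT -(mulGSid sNtN) -mulgA mem_mulg.
apply/subsetP=> _ /setIP[/mulsgP[G A tNG DA ->] /setIdP[nNGA /eqP psiGA]].
have nNG : G \in 'N(N) := subsetP nNtN G tNG.
have nNA : A \in 'N(N) by rewrite -(groupMl _ nNG).
have [g _ tNg DG] := morphimP tNG; have [a _ Da DA'] := morphimP DA.
rewrite /= in DG DA'.
(* The character is pulled back to N inside GL(Fq), where [tNq_fixed] is stated. *)
pose psi0 := cfMorph psi.
have irr_psi0 : psi0 \in irr (Nq_group l iota) by rewrite cfMorph_irr ?subsetT.
have psi0E x : x \in Nq_group l iota -> psi0 x = psi (sdpair1 _ x).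
  by move=> Nx; rewrite /psi0 cfMorphE ?subsetT.
have /cycleP[k Dak] := Da.
have conjG x : sdpair1 _ x ^ G^-1 = sdpair1 (D_action l p_pr cardFq)
  (g * x * g^-1).
  by rewrite DG -morphV ?inE // -morphJ ?inE // conjgE invgK mulgA.
have conjA x : sdpair1 _ x ^ A = sdpair1 (D_action l p_pr cardFq) (a x).
  by rewrite DA' -sdpair_act ?inE.
have Nconj x : x \in Nq_group l iota -> g * x * g^-1 \in Nq_group l iota.
  move=> Nx; rewrite -[g in g * x]invgK -mulgA -conjgE memJ_norm // groupV.
  exact: subsetP (tN_norm l iota) g tNg.
have NX x : x \in Nq_group l iota -> sdpair1 (D_action l p_pr cardFq) x \in N.
  by move=> Nx; apply: (mem_morphim _ (in_setT x) Nx).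
have Na x : x \in Nq_group l iota -> a x \in Nq_group l iota.
  move=> Nx; have := NX x Nx; rewrite -(memJ_norm _ nNA) conjA =>
    /morphimP[y _ Ny].
  have /injmP inj1 := injm_sdpair1 (D_action l p_pr cardFq).
  by move/(inj1 _ _ (in_setT _) (in_setT _)) => ->.
(* As [psi] is fixed by [G * A], its values at the conjugates of an element by [G^-1] and by [A]
   agree, which is the hypothesis of [tNq_fixed]. *)
have fixg : {in Nq_group l iota, forall x, psi0 (g * x * g^-1) = psi0 x}.
  have := tNq_fixed (p_pr := p_pr) (cardFq := cardFq) (k := k) irr_psi0 tNg.
  apply=> y Ny; rewrite -Dak !psi0E ?Nconj ?Na // -conjG -conjA.
  rewrite -[in RHS]psiGA cfConjgE // invMg conjgM.
  by rewrite -(conjgM _ A) mulgV conjg1.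
have psiG : (psi ^ G)%CF = psi.
  apply/cfun_inP=> _ /morphimP[x _ Nx ->].
  rewrite cfConjgE // [_ ^ _]conjG -psi0E ?Nconj // -[RHS]psi0E //.
  exact: fixg.
have psiA : (psi ^ A)%CF = psi.
  rewrite -[RHS]psiGA -[in LHS]psiG.
  by rewrite (cfConjgMnorm psi nNG nNA).
apply/mulsgP; exists G A => //; apply/setIP; split=> //.
- by apply/setIdP; rewrite psiG.
- by rewrite -[A]mul1g mem_mulg.
by apply/setIdP; rewrite psiA.
Qed.
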